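(* Fix $k\ge2$ and $d\in\mathbb{N}$. Let $a\colon\mathbb{N}_0\to\Omega\subset\mathbb{C}$ be a totally balanced invertible $k$-automatic sequence. Then there exists a constant $c>0$ such that $$\sup_{\substack{p(x)\in\mathbb{R}[x]\\ \deg p\le d}} \left| \mathbb{E}_{n<N}\, a(n)\, e(p(n)) \right| \ll N^{-c}$$ (with $c$ and the implicit constant depending on $a$, $k$, $d$ but not on $N$).
   Context: $\mathbb{N}=\{1,2,\dots\}$, $\mathbb{N}_0=\mathbb{N}\cup\{0\}$, $\mathbb{E}_{n<N}\,x(n)=\frac1N\sum_{n=0}^{N-1}x(n)$, $e(\theta)=e^{2\pi i\theta}$. $X\ll Y$ means $|X|\le CY$ for some constant $C$. Invertible automatic sequences: let $\Sigma_k=\{0,\dots,k-1\}$ and let $\Sigma_k^*$ be the set of finite words over $\Sigma_k$ (including the empty word), a monoid under concatenation. For $n\in\mathbb{N}_0$, $(n)_k\in\Sigma_k^*$ is the base-$k$ expansion of $n$ without leading zeros, most significant digit on the left ($(0)_k$ is the empty word). A generalised Thue–Morse sequence in a finite group $G$ is a map $g\colon\Sigma_k^*\to G$ with $g(uv)=g(u)g(v)$ for all $u,v\in\Sigma_k^*$ and $g(0)=\mathrm{id}_G$ (where $0\in\Sigma_k$ is the one-letter word); write $g(n)=g((n)_k)$. A sequence $a\colon\mathbb{N}_0\to\Omega$ is an invertible $k$-automatic sequence if there are a finite group $G$, a generalised Thue–Morse sequence $g\colon\Sigma_k^*\to G$ and a map $\pi\colon G\to\Omega$ with $a(n)=\pi(g(n))$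 for all $n\in\mathbb{N}_0$. A bounded sequence $a\colon\mathbb{N}_0\to\mathbb{C}$ is totally balanced if $\mathbb{E}_{n<N}\,a(qn+r)\to0$ as $N\to\infty$ for every $q\in\mathbb{N}$, $r\in\mathbb{N}_0$ (equivalently, $\mathbb{E}_{n<N}\,a(n)b(n)\to 0$ for every periodic $b$). *)

(* Defs.v *)
From HB Require Import structures.
From mathcomp Require Import all_boot all_order all_algebra all_fingroup.
From mathcomp Require Import complex.
From mathcomp Require Import all_classical all_reals all_analysis.

Set Implicit Arguments.
Unset Strict Implicit.
Unset Printing Implicit Defensive.

Import Order.TTheory GRing.Theory Num.Theory.
Import numFieldNormedType.Exports.

Local Open Scope ring_scope.
Local Open Scope complex_scope.
Local Open Scope classical_set_scope.

Section Words.
Variables (k : nat) (k_gt1 : (1 < k)%N).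

Definition digit (n : nat) : 'I_k := Ordinal (ltn_pmod n (ltnW k_gt1)).

(* [fuel = n] is always enough, because [n %/ k < n] for [n > 0];
   see [expansion_rcons]. *)
Fixpoint expansion_rec (fuel n : nat) : seq 'I_k :=
  if fuel is fuel'.+1 then
    if n == 0%N then [::]
    else rcons (expansion_rec fuel' (n %/ k)%N) (digit n)
  else [::].

(* The word (n)_k: most significant digit first, no leading zeros, and
   the empty word for n = 0. *)
Definition expansion (n : nat) : seq 'I_k := expansion_rec n n.

Lemma expansion0 : expansion 0 = [::]. Proof. by []. Qed.

Lemma expansion_rec_fuel (f f' n : nat) :
  (n <= f)%N -> (n <= f')%N -> expansion_rec f n = expansion_rec f' n.
Proof.
elim: f f' n => [|f IHf] [|f'] [|n] //= le_nf le_nf'.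
have lt_div : (n.+1 %/ k <= n)%N by rewrite -ltnS ltn_Pdiv.
by congr rcons; apply: IHf; apply: leq_trans lt_div _; rewrite -ltnS.
Qed.

Lemma expansion_rcons (n : nat) :
  (0 < n)%N -> expansion n = rcons (expansion (n %/ k)) (digit n).
Proof.
case: n => // n _; rewrite /expansion /=; congr rcons.
by apply: expansion_rec_fuel => //; rewrite -ltnS ltn_Pdiv.
Qed.

Definition generalised_thue_morse (gT : finGroupType) (g : seq 'I_k -> gT) :=
  (forall u v, g (u ++ v) = (g u * g v)%g) /\ g [:: digit 0] = 1%g.

Definition invertible_automatic (Omega : Type) (a : nat -> Omega) : Prop :=
  exists (gT : finGroupType) (g : seq 'I_k -> gT) (proj : gT -> Omega),
    generalised_thue_morse g /\ forall n, a n = proj (g (expansion n)).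

End Words.

Section Averages.
Variable R : realType.

Definition average (N : nat) (x : nat -> R[i]) : R[i] :=
  N%:R^-1 * \sum_(n < N) x n.

(* e(t) = exp(2 pi i t) *)
Definition e (t : R) : R[i] := cos (2 * pi * t) +i* sin (2 * pi * t).

(* [Normc.normc] is the modulus with values in [R]; the generic norm on
   [R[i]] takes values in [R[i]].  The alias [R[i]^o] is the type on which
   the norm topology of [R[i]] is declared. *)
Definition totally_balanced (a : nat -> R[i]) : Prop :=
  (exists M : R, forall n, Normc.normc (a n) <= M) /\
  forall q r : nat, (0 < q)%N ->
    average N (fun n => a (q * n + r)%N) @[N --> \oo] --> (0 : R[i]^o).

End Averages.

(* Main.v *)
Require Import Defs.
From mathcomp Require Import all_boot all_order all_algebra all_fingroup.
From mathcomp Require Import cyclic complex.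
From mathcomp Require Import all_classical all_reals all_analysis.

(** Write [gam n] for the group value of the digits of [n] and [a n = f (gam n)].
    Cutting [n] at a digit position cuts [gam n] into a product
    ([thue_morse_cut]). Put [s = d + 1].

    A polynomial phase of degree at most [d] disappears when the
    Cauchy-Schwarz inequality is applied once in each of [s] directions
    ([gowers_cauchy_schwarz]); what is left is a mean of products of [f] over the
    [2 ^ s] vertices of random cubes of integers. The directions have to be
    chosen well: if the vertices of the cubes were obtained by adding digits
    without carries, [gam] could look linear on them and nothing would be gained.
    So [n] is written in blocks of digits of a fixed length, and inside the
    blocks one inserts integer cubes whose additions do carry, while no carry
    crosses the boundary of a block.

    Which cubes are useful is governed by the corner group [H]: the set of all [h]
    for which some integer cube has value [h] under [gam] at its top vertex
    and [1] at every other vertex. It is a subgroup normalised by the values of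
    [gam], because cubes can be multiplied by writing them in disjoint digit
    positions, and a single system of integers realises all of its elements
    ([universal_cube]).

    If [f] sums to zero over the cosets of [H], the exponential sums of
    [f (gam n)] save a power ([long_sum_saving]). Indeed a random cube in a block
    carries, with positive probability, a uniform element of [H] at the top
    vertex and [1] elsewhere; such a block makes the expected product vanish, and
    the probability that no block of [n] is of this kind is exponentially small in
    the number of digits ([pattern_bound], [block_mean_bound]).

    It remains to see that total balance makes [f] sum to zero over the cosets of
    [H] ([corner_free_balanced]). Modulo [H] the top vertex of a cube is a function
    of the other vertices. Applied to the cubes of consecutive integers
    [n, ..., n + s], this is a recurrence of order [s] with finitely many states,
    so [gam] is eventually periodic modulo [H]
    ([eventually_periodic_mod_corner_group]). The coset means [f0] of [f] are thus
    periodic along [gam], and total balance says that [f] does not correlate with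
    them; since [f - f0] does not either, by the power saving, [f0 = 0]. *)

Set Implicit Arguments.
Unset Strict Implicit.
Unset Printing Implicit Defensive.

Import Order.TTheory GRing.Theory Num.Theory.
Import numFieldNormedType.Exports.

Local Open Scope ring_scope.

(** * Means over finite types and over words *)

Section Mean.
Variable C : numClosedFieldType.

Definition mean (X : finType) (F : X -> C) : C := #|X|%:R^-1 * \sum_x F x.

Lemma eq_mean (X : finType) (F G : X -> C) : F =1 G -> mean F = mean G.
Proof. by move=> FG; rewrite /mean (eq_bigr G). Qed.

Lemma meanZ (X : finType) c (F : X -> C) :
  mean (fun x => c * F x) = c * mean F.
Proof. by rewrite /mean -mulr_sumr mulrCA. Qed.

Lemma meanD (X : finType) (F G : X -> C) :
  mean (fun x => F x + G x) = mean F + mean G.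
Proof. by rewrite /mean big_split mulrDr. Qed.

Lemma mean_cst (X : finType) (c : C) : (0 < #|X|)%N -> mean (fun _ : X => c) = c.
Proof.
move=> X0; rewrite /mean sumr_const -[c *+ _]mulr_natl mulrA mulVf ?mul1r //.
by rewrite pnatr_eq0 -lt0n.
Qed.

Lemma mean_exchange (X Y : finType) (F : X -> Y -> C) :
  mean (fun x => mean (F x)) = mean (fun y => mean (fun x => F x y)).
Proof. by rewrite /mean -!mulr_sumr exchange_big mulrCA. Qed.

Lemma mean_pair (X Y : finType) (F : X -> Y -> C) :
  mean (fun x => mean (F x)) = mean (fun u : X * Y => F u.1 u.2).
Proof.
by rewrite /mean -mulr_sumr pair_big /= mulrA -invfM -natrM mulnC card_prod mulnC.
Qed.

Lemma ler_mean (X : finType) (F G : X -> C) :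
  (forall x, F x <= G x) -> mean F <= mean G.
Proof.
by move=> FG; rewrite ler_wpM2l ?invr_ge0 ?ler0n // ler_sum.
Qed.

Lemma mean_ge0 (X : finType) (F : X -> C) : (forall x, 0 <= F x) -> 0 <= mean F.
Proof. by move=> F0; rewrite mulr_ge0 ?invr_ge0 ?ler0n ?sumr_ge0. Qed.

Lemma norm_mean (X : finType) (F : X -> C) : `|mean F| <= mean (fun x => `|F x|).
Proof.
rewrite normrM ger0_norm ?invr_ge0 ?ler0n //.
by rewrite ler_wpM2l ?invr_ge0 ?ler0n // ler_norm_sum.
Qed.

Lemma conj_mean (X : finType) (F : X -> C) :
  (mean F)^* = mean (fun x => (F x)^*).
Proof. by rewrite /mean rmorphM rmorph_sum fmorphV rmorph_nat. Qed.

(** One step of van der Corput differencing: it trades a variable for a pair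
    of copies of it. *)
Lemma sqr_norm_mean (X : finType) (F : X -> C) :
  `|mean F| ^+ 2 = mean (fun u : X * X => F u.1 * (F u.2)^*).
Proof.
rewrite normCK -(mean_pair (fun x y => F x * (F y)^*)) conj_mean mulrC -meanZ.
by apply: eq_mean => x; rewrite meanZ mulrC.
Qed.

Lemma sqr_mean_le (X : finType) (F : X -> C) :
  `|mean F| ^+ 2 <= mean (fun x => `|F x| ^+ 2).
Proof.
have [X0|X0] := posnP #|X|.
  rewrite /mean X0 invr0 !mul0r normr0 expr0n /=; exact: lexx.
set u := fun x => `|F x|; set m := mean u.
have u0 x : 0 <= u x by rewrite normr_ge0.
have m0 : 0 <= m by apply: mean_ge0.
apply: (@le_trans _ _ (m ^+ 2)).
  by rewrite lerXn2r ?nnegrE ?normr_ge0 // norm_mean.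
(* the variance of |F| is nonnegative *)
have : 0 <= mean (fun x => (u x - m) ^+ 2).
  apply: mean_ge0 => x; rewrite real_exprn_even_ge0 //.
  by rewrite rpredB ?ger0_real.
rewrite (@eq_mean _ _ (fun x => u x ^+ 2 + (- m *+ 2 * u x + m ^+ 2))); last first.
  by move=> x; rewrite sqrrB addrA mulNrn mulNr mulrnAl [m * _]mulrC.
rewrite meanD meanD meanZ mean_cst // -/m mulrnAl mulNr -expr2.
by rewrite mulr2n -addrA addNr addr0 subr_ge0.
Qed.

Lemma expr_mean_le (X : finType) (F : X -> C) (j : nat) :
  `|mean F| ^+ (2 ^ j) <= mean (fun x => `|F x| ^+ (2 ^ j)).
Proof.
elim: j => [|j IHj]; first by rewrite !expr1; exact: norm_mean.
rewrite expnSr exprM.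
apply: (@le_trans _ _ (`|mean (fun x => `|F x| ^+ (2 ^ j))| ^+ 2)).
  rewrite lerXn2r ?nnegrE ?exprn_ge0 ?normr_ge0 //.
  apply: (le_trans IHj); apply/real_ler_norm/ger0_real/mean_ge0 => x.
  exact/exprn_ge0.
apply: (le_trans (sqr_mean_le _)); apply: ler_mean => x.
by rewrite exprM ger0_norm // exprn_ge0.
Qed.

Lemma reindex_mean (X Y : finType) (h : Y -> X) (F : X -> C) :
  bijective h -> mean F = mean (F \o h).
Proof.
move=> bij_h; rewrite /mean (bij_eq_card bij_h); congr (_ * _).
rewrite (reindex h) //; exact: onW_bij.
Qed.

(** The mean over words of length [s], taken one letter at a time so that the
    differencing argument can remove the variables by recursion on [s]. *)
Fixpoint imean (X : finType) (s : nat) (F : seq X -> C) : C :=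
  if s is s'.+1 then mean (fun x => imean s' (fun l => F (x :: l)))
  else F [::].

Lemma eq_imean (X : finType) s (F G : seq X -> C) :
  (forall l, size l = s -> F l = G l) -> imean s F = imean s G.
Proof.
elim: s F G => [|s IHs] F G FG /=; first exact: FG.
by apply: eq_mean => x; apply: IHs => l ls; apply: FG; rewrite /= ls.
Qed.

Lemma imean_exchange (X Y : finType) s (F : X -> seq Y -> C) :
  mean (fun x => imean s (F x)) = imean s (fun l => mean (fun x => F x l)).
Proof.
elim: s F => [|s IHs] F //=.
by rewrite mean_exchange; apply: eq_mean => y; apply: IHs.
Qed.

Lemma sqr_imean_le (X : finType) s (F : seq X -> C) :
  `|imean s F| ^+ 2 <= imean s (fun l => `|F l| ^+ 2).
Proof.
elim: s F => [|s IHs] F //=; apply: le_trans (sqr_mean_le _) _.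
by apply: ler_mean => x; apply: IHs.
Qed.

Lemma imean_tuple (X : finType) s (F : seq X -> C) :
  imean s F = mean (fun l : s.-tuple X => F l).
Proof.
elim: s F => [|s IHs] F /=.
  rewrite -[LHS](@mean_cst [the finType of 0.-tuple X]) ?card_tuple //.
  by apply: eq_mean => l; rewrite tuple0.
under eq_mean => x do rewrite IHs.
rewrite (mean_pair (fun x (l : s.-tuple X) => F (x :: l))).
pose h (u : X * s.-tuple X) := [tuple of u.1 :: u.2].
have bij_h : bijective h.
  exists (fun l : s.+1.-tuple X => (thead l, [tuple of behead l])).
    by case=> x l; rewrite /h /= theadE; congr pair; apply: val_inj.
  by move=> l; rewrite /h /= -tuple_eta.
by rewrite (reindex_mean (fun l : s.+1.-tuple X => F l) bij_h).
Qed.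

Lemma imean_map (X Y : finType) s (h : Y -> X) (F : seq X -> C) :
  bijective h -> imean s F = imean s (fun l => F (map h l)).
Proof.
move=> bij_h; elim: s F => [|s IHs] F //=.
by rewrite (reindex_mean _ bij_h); apply: eq_mean => y /=; apply: IHs.
Qed.

End Mean.

(** * Gowers-Cauchy-Schwarz for polynomial phases *)

Section CubeProducts.
Variable C : numClosedFieldType.

(** The product in a Gowers norm: the factor at a vertex of the cube is
    conjugated once for each [true] of the vertex. *)
Fixpoint cube_prod (s : nat) (phi : seq bool -> C) : C :=
  if s is s'.+1 then
    cube_prod s' (phi \o cons false) * (cube_prod s' (phi \o cons true))^*
  else phi [::].

Lemma eq_cube_prod s (phi psi : seq bool -> C) :
  (forall om, size om = s -> phi om = psi om) -> cube_prod s phi = cube_prod s psi.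
Proof.
elim: s phi psi => [|s IHs] phi psi E /=; first exact: E.
by congr (_ * _^*); apply: IHs => om oms; apply: E; rewrite /= oms.
Qed.

Lemma cube_prodM s (phi psi : seq bool -> C) :
  cube_prod s (fun om => phi om * psi om) = cube_prod s phi * cube_prod s psi.
Proof.
elim: s phi psi => [|s IHs] phi psi //=.
by rewrite /comp !IHs rmorphM /= mulrACA.
Qed.

Lemma conj_cube_prod s (phi : seq bool -> C) :
  cube_prod s (fun om => (phi om)^*) = (cube_prod s phi)^*.
Proof.
elim: s phi => [|s IHs] phi //=.
by rewrite /comp !IHs rmorphM.
Qed.

Lemma norm_cube_prod_le s (phi : seq bool -> C) (M : C) :
  (forall om, `|phi om| <= M) -> `|cube_prod s phi| <= M ^+ (2 ^ s).
Proof.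
elim: s phi => [|s IHs] phi phiM /=; first by rewrite expr1.
rewrite normrM norm_conjC expnS mul2n -addnn exprD.
by rewrite ler_pM ?normr_ge0 // IHs // => om; apply: phiM.
Qed.

(** A cube product is linear (up to conjugation) in the value at the top
    vertex, so summing that value to zero with the other vertices held fixed
    kills the product. *)
Lemma cube_prod_sum0 (I : finType) (D : {set I}) s (phi : I -> seq bool -> C) :
  (forall om, size om = s -> om != nseq s true ->
     {in D &, forall i j, phi i om = phi j om}) ->
  \sum_(i in D) phi i (nseq s true) = 0 ->
  \sum_(i in D) cube_prod s (phi i) = 0.
Proof.
elim: s phi => [|s IHs] phi E S0 //=.
have [->|[i0 Di0]] := set_0Vmem D; first by rewrite big_set0.
rewrite (eq_bigr (fun i => cube_prod s (phi i0 \o cons false)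
                           * (cube_prod s (phi i \o cons true))^*)); last first.
  move=> i Di; congr (_ * _); apply: eq_cube_prod => om oms /=.
  by apply: E; rewrite //= oms.
rewrite -mulr_sumr -rmorph_sum /= IHs ?rmorph0 ?mulr0 //.
by move=> om oms omN i j Di Dj /=; apply: E; rewrite //= oms.
Qed.

End CubeProducts.

(** A word of pairs spans a combinatorial cube; [om] selects a vertex of it. *)
Definition vertex (X : Type) (om : seq bool) (P : seq (X * X)) : seq X :=
  [seq if u.1 then u.2.2 else u.2.1 | u <- zip om P].

(** The integers [W 0 z_0 + W 1 z_1 + ...] generalise arithmetic cubes
    [b + om . w]: each coordinate contributes independently of the others. *)
Fixpoint coord_sum (Z : Type) (W : nat -> Z -> nat) (l : seq Z) : nat :=
  if l is z :: l' then (W 0 z + coord_sum (fun i => W i.+1) l')%N else 0%N.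

(** Differencing lowers the degree: both shifts keep the leading term. *)
Lemma size_shift_sub (R : idomainType) (p : {poly R}) (a b : R) n :
  (size p <= n.+1)%N ->
  (size ((p \Po ('X + a%:P)) - (p \Po ('X + b%:P)))%R <= n)%N.
Proof.
move=> pn; set pa := p \Po _; set pb := p \Po _.
have szX c : size ('X + c%:P : {poly R}) = 2%N by rewrite size_XaddC.
have lcX c : lead_coef ('X + c%:P : {poly R}) = 1 by rewrite lead_coefXaddC.
have sa : size pa = size p by rewrite size_comp_poly2.
have sb : size pb = size p by rewrite size_comp_poly2.
have la : lead_coef pa = lead_coef p.
  by rewrite lead_coef_comp ?szX // lcX expr1n mulr1.
have lb : lead_coef pb = lead_coef p.
  by rewrite lead_coef_comp ?szX // lcX expr1n mulr1.
apply/leq_sizeP => j nj; rewrite coefB.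
have [pj|pj] := leqP (size p) j.
  by rewrite !nth_default ?subrr // ?sa ?sb.
have jE : j = (size p).-1.
  apply/eqP; rewrite -eqSS prednK; last exact: leq_ltn_trans pj.
  by rewrite eqn_leq pj (leq_trans pn).
move: la lb; rewrite !lead_coefE sa sb -jE => -> ->; exact: subrr.
Qed.

Section Gowers.
Variables (C : numClosedFieldType) (R : idomainType) (chi : R -> C).
Hypothesis chiB : forall x y, chi (x - y) = chi x * (chi y)^*.
Hypothesis chi1 : forall x, `|chi x| = 1.

(** A phase of degree at most [d] does not survive [d.+1] differencings. Since
    the phase is evaluated at a sum of one contribution per coordinate,
    replacing a coordinate by a pair of copies leaves a difference polynomial
    evaluated at the sum over the remaining coordinates, and recursion applies.
    The recursion stops at one coordinate rather than none, because the bound is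
    nonnegative only after at least one squaring. *)
Lemma gowers_cauchy_schwarz (X : finType) d (F : seq X -> C)
    (V : nat -> X -> nat) (p : {poly R}) :
  (size p <= d.+1)%N ->
  `|imean d.+1 (fun l => F l * chi p.[(coord_sum V l)%:R])| ^+ (2 ^ d.+1)
  <= imean d.+1 (fun P : seq (X * X) => cube_prod d.+1 (fun om => F (vertex om P))).
Proof.
have eqW (x y : C) : x = y -> x <= y by move->.
elim: d F V p => [|d IHd] F V p sp.
  rewrite expn1 /= sqr_norm_mean; apply/eqW/eq_mean => -[x y] /=.
  rewrite /vertex /= (size1_polyC sp) !hornerC rmorphM mulrACA -normCK chi1.
  by rewrite expr1n mulr1.
set Psi := fun l => _; set d1 := d.+1.
have -> : imean d1.+1 Psi =
    imean d1 (fun l => mean (fun x => Psi (x :: l))).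
  by rewrite -imean_exchange.
rewrite expnS exprM.
pose q (u : X * X) : {poly R} :=
  (p \Po ('X + (V 0 u.1)%:R%:P)) - (p \Po ('X + (V 0 u.2)%:R%:P)).
pose Fu (u : X * X) l := F (u.1 :: l) * (F (u.2 :: l))^*.
pose V' i := V i.+1.
have qE u l : Psi (u.1 :: l) * (Psi (u.2 :: l))^* =
    Fu u l * chi (q u).[(coord_sum V' l)%:R].
  rewrite /Psi /= rmorphM mulrACA; congr (_ * _).
  by rewrite -chiB /q hornerD hornerN !horner_comp !hornerE !natrD
     ![_ + (coord_sum _ _)%:R]addrC.
have sqE : imean d1 (fun l => `|mean (fun x => Psi (x :: l))| ^+ 2) =
    mean (fun u => imean d1 (fun l => Fu u l * chi (q u).[(coord_sum V' l)%:R])).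
  rewrite imean_exchange; apply: eq_imean => l _.
  by rewrite sqr_norm_mean; apply: eq_mean => u; apply: qE.
have le1 := sqr_imean_le d1 (fun l => mean (fun x => Psi (x :: l))).
rewrite sqE in le1.
have le2 : `|imean d1 (fun l => mean (fun x => Psi (x :: l)))| ^+ 2 ^+ (2 ^ d1)
   <= `|mean (fun u => imean d1
          (fun l => Fu u l * chi (q u).[(coord_sum V' l)%:R]))| ^+ (2 ^ d1).
  move: (2 ^ d1)%N => m; rewrite lerXn2r ?nnegrE ?exprn_ge0 ?normr_ge0 //.
  apply: (le_trans le1); apply/real_ler_norm/ger0_real.
  by apply: le_trans le1; rewrite exprn_ge0.
apply: (le_trans le2); apply: (le_trans (expr_mean_le _ _)).
rewrite -[leRHS]/(mean (fun u : X * X => imean d1 (fun P : seq (X * X) =>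
  cube_prod d1.+1 (fun om => F (vertex om (u :: P)))))).
apply: ler_mean => u.
apply: le_trans (IHd (Fu u) V' (q u) _) _.
  exact: size_shift_sub.
apply: eqW; apply: eq_imean => P _.
rewrite -[RHS]/(cube_prod d1 _ * (cube_prod d1 _)^*) -conj_cube_prod -cube_prodM.
by apply: eq_cube_prod => om _ /=; case: u.
Qed.

End Gowers.

(** * Cubes in generalised Thue-Morse sequences and the corner group *)

Section GeneralisedThueMorse.
Variables (k : nat) (k_gt1 : (1 < k)%N) (gT : finGroupType).
Variables (g : seq 'I_k -> gT).
Hypothesis g_tm : generalised_thue_morse k_gt1 g.

Lemma thue_morse_nil : g [::] = 1%g.
Proof.
have [gM _] := g_tm; apply: (mulgI (g [::])).
by rewrite mulg1 -gM.
Qed.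

Lemma thue_morse_digit n :
  g (expansion k_gt1 n) =
  (g (expansion k_gt1 (n %/ k)) * g [:: digit k_gt1 n])%g.
Proof.
have [gM g0] := g_tm; case: n => [|n].
  by rewrite div0n expansion0 thue_morse_nil mul1g g0.
by rewrite expansion_rcons // -cats1 gM.
Qed.

(** Leading zeros are invisible to [g], so cutting an integer at any digit
    position cuts its value in two. *)
Lemma thue_morse_cut m j n : (n < k ^ j)%N ->
  g (expansion k_gt1 (m * k ^ j + n)) =
  (g (expansion k_gt1 m) * g (expansion k_gt1 n))%g.
Proof.
have k0 : (0 < k)%N by apply: ltnW.
elim: j n => [|j IHj] n.
  by rewrite expn0 ltnS leqn0 muln1 => /eqP->; rewrite addn0 expansion0
     thue_morse_nil mulg1.
move=> nk; rewrite thue_morse_digit expnSr mulnA divnMDl // IHj; last first.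
  by rewrite ltn_divLR // -expnSr.
rewrite (thue_morse_digit n) mulgA; congr (_ * g [:: _])%g.
by apply: val_inj; rewrite /= modnMDl.
Qed.

End GeneralisedThueMorse.

Section Cubes.
Variables (k : nat) (k_gt1 : (1 < k)%N) (gT : finGroupType) (gam : nat -> gT).
Hypothesis gam_cut : forall m j n, (n < k ^ j)%N ->
  gam (m * k ^ j + n) = (gam m * gam n)%g.

Lemma gam0 : gam 0 = 1%g.
Proof.
apply: (mulgI (gam 0)); rewrite mulg1.
by rewrite -(@gam_cut 0 0 0) // mul0n addn0.
Qed.

Definition attained (x : gT) : Prop := exists n, gam n = x.

Lemma attainedM x y : attained x -> attained y -> attained (x * y)%g.
Proof.
move=> [m <-] [n <-]; exists (m * k ^ n + n)%N.
by rewrite gam_cut // ltn_expl.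
Qed.

Lemma attained1 : attained 1%g. Proof. by exists 0; exact: gam0. Qed.

(** Inverses are positive powers in a finite group. *)
Lemma attainedV x : attained x -> attained (x^-1)%g.
Proof.
move=> ax; have aX n : attained (x ^+ n)%g.
  elim: n => [|n IHn]; first exact: attained1.
  by rewrite expgS; apply: attainedM.
suff -> : (x^-1)%g = (x ^+ #|[set: gT]|.-1)%g by apply: aX.
apply: (mulgI x); rewrite mulgV -expgS prednK ?cardG_gt0 //.
by rewrite expg_cardG ?inE.
Qed.

(** Functions on words that [gam] realises on a generalised cube of integers.
    On such cubes pointwise products are available: the integers of one cube are
    written in the high digits and those of another in the low digits. *)
Definition representable (Z : Type) (s : nat) (phi : seq Z -> gT) : Prop :=
  exists W : nat -> Z -> nat, forall z, size z = s -> gam (coord_sum W z) = phi z.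

Lemma coord_sum_bounded (Z : finType) s (W : nat -> Z -> nat) :
  exists j, forall z, size z = s -> (coord_sum W z < k ^ j)%N.
Proof.
suff [b bP] : exists b, forall z, size z = s -> (coord_sum W z <= b)%N.
  by exists b => z zs; apply: leq_ltn_trans (bP z zs) (ltn_expl _ _).
elim: s W => [|s IHs] W; first by exists 0 => z /size0nil->.
have [b bP] := IHs (fun i => W i.+1).
exists (\max_z W 0 z + b)%N => -[|z l] //= [ls].
by apply: leq_add; [exact: leq_bigmax|exact: bP].
Qed.

Lemma coord_sumD (Z : Type) (W W' : nat -> Z -> nat) c z :
  coord_sum (fun i x => (W i x * c + W' i x)%N) z = (coord_sum W z * c + coord_sum W' z)%N.
Proof.
elim: z W W' => [|x z IHz] W W' //=.
by rewrite (IHz (fun i => W i.+1) (fun i => W' i.+1)) mulnDl addnACA.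
Qed.

Lemma representableM (Z : finType) s (phi psi : seq Z -> gT) :
  representable s phi -> representable s psi ->
  representable s (fun z => phi z * psi z)%g.
Proof.
move=> [W Wphi] [W' Wpsi]; have [j jP] := coord_sum_bounded s W'.
exists (fun i x => (W i x * k ^ j + W' i x)%N) => z zs.
by rewrite coord_sumD gam_cut ?jP // Wphi // Wpsi.
Qed.

Lemma eq_representable (Z : Type) s (phi psi : seq Z -> gT) :
  (forall z, size z = s -> phi z = psi z) ->
  representable s phi -> representable s psi.
Proof. by move=> E [W WP]; exists W => z zs; rewrite WP // E. Qed.

Lemma representable1 (Z : Type) s : @representable Z s (fun _ => 1%g).
Proof.
exists (fun _ _ => 0%N) => z zs; rewrite -gam0; congr gam.
by elim: z {s zs} => //= x z ->.
Qed.

Lemma representableX (Z : finType) s (phi : seq Z -> gT) n :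
  representable s phi -> representable s (fun z => phi z ^+ n)%g.
Proof.
move=> rphi; elim: n => [|n IHn]; first exact: representable1.
apply: eq_representable (representableM rphi IHn) => z _.
by rewrite expgS.
Qed.

Lemma representableV (Z : finType) s (phi : seq Z -> gT) :
  representable s phi -> representable s (fun z => (phi z)^-1)%g.
Proof.
move=> /(@representableX _ _ _ #|[set: gT]|.-1); apply: eq_representable => z _.
apply: (mulgI (phi z)); rewrite mulgV -expgS prednK ?cardG_gt0 //.
by rewrite expg_cardG ?inE.
Qed.

Lemma representable_cst (Z : Type) s x :
  attained x -> @representable Z s.+1 (fun _ => x).
Proof.
move=> [n <-]; exists (fun i _ => if i is 0 then n else 0%N).
move=> [|z l] //= _; congr gam; rewrite -[RHS]addn0; congr addn.
by elim: l => //= ? ? ->.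
Qed.

Fixpoint mapi (Z Y : Type) (sg : nat -> Z -> Y) (z : seq Z) : seq Y :=
  if z is x :: z' then sg 0%N x :: mapi (fun i => sg i.+1) z' else [::].

Lemma size_mapi (Z Y : Type) (sg : nat -> Z -> Y) z : size (mapi sg z) = size z.
Proof. by elim: z sg => //= x z IHz sg; rewrite IHz. Qed.

Lemma representable_mapi (Z Y : Type) s (sg : nat -> Z -> Y) phi :
  representable s phi -> representable s (fun z => phi (mapi sg z)).
Proof.
move=> [W WP]; exists (fun i x => W i (sg i x)) => z zs.
rewrite -WP ?size_mapi //; congr gam.
elim: z W sg {zs WP} => //= x z IHz W sg; congr addn.
exact: (IHz (fun i => W i.+1) (fun i => sg i.+1)).
Qed.

Definition corner (h : gT) (om : seq bool) : gT := if all id om then h else 1%g.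

(** The group of values that a cube can have at its top vertex while being
    trivial at all the others. A function that averages to zero over its cosets
    is invisible to cube products, and modulo it [gam] is rigid. *)
Definition corner_group (s : nat) : {set gT} :=
  finset (fun h => `[< representable s (corner h) >]).

Lemma corner_groupP s h :
  reflect (representable s (corner h)) (h \in corner_group s).
Proof. by rewrite inE; apply: asboolP. Qed.

Lemma corner_group1 s : 1%g \in corner_group s.
Proof.
apply/corner_groupP; apply: eq_representable (@representable1 _ s) => z _.
by rewrite /corner; case: ifP.
Qed.

Lemma corner_groupM s h h' :
  h \in corner_group s -> h' \in corner_group s -> (h * h')%g \in corner_group s.
Proof.
move=> /corner_groupP rh /corner_groupP rh'; apply/corner_groupP.
apply: eq_representable (representableM rh rh') => z _.
by rewrite /corner; case: ifP; rewrite ?mulg1.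
Qed.

Lemma corner_groupV s h : h \in corner_group s -> (h^-1)%g \in corner_group s.
Proof.
move=> /corner_groupP rh; apply/corner_groupP.
apply: eq_representable (representableV rh) => z _.
by rewrite /corner; case: ifP; rewrite ?invg1.
Qed.

(** A conjugating element is a constant cube, written in the digits around the
    given one. *)
Lemma corner_groupJ s h x :
  attained x -> h \in corner_group s.+1 -> (x * h * x^-1)%g \in corner_group s.+1.
Proof.
move=> ax /corner_groupP rh; apply/corner_groupP.
have rx := @representable_cst bool s x ax.
apply: eq_representable (representableM (representableM rx rh) (representableV rx)).
by move=> z _; rewrite /corner; case: ifP; rewrite ?mulg1 ?mulgV.
Qed.

(** Reflecting the cube moves the special vertex anywhere. *)
Lemma representable_vertex s h (v : seq bool) : size v = s -> h \in corner_group s ->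
  representable s (fun om => if om == v then h else 1%g).
Proof.
move=> vs /corner_groupP /(representable_mapi (fun i b => b == nth false v i)).
apply: eq_representable => om oms; rewrite /corner.
suff -> : all id (mapi (fun i b => b == nth false v i) om) = (om == v) by [].
elim: om v {s h vs oms}(etrans oms (esym vs)) => [|b om IHom] [|c v] //= [E].
by rewrite IHom // eqseq_cons.
Qed.

(** Cubes whose lower vertices lie in the corner group have their top vertex
    there too, because the lower vertices can be cleared one at a time. *)
Lemma corner_group_top s (chi : seq bool -> gT) :
  representable s chi ->
  (forall om, size om = s -> om != nseq s true -> chi om \in corner_group s) ->
  chi (nseq s true) \in corner_group s.
Proof.
move=> rchi chiH.
have clear (vs : seq (seq bool)) :
    exists2 psi, representable s psi &
      [/\ psi (nseq s true) = chi (nseq s true),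
          forall om, size om = s -> om != nseq s true ->
            psi om \in corner_group s
        & forall om, size om = s -> om != nseq s true -> om \in vs ->
            psi om = 1%g].
  elim: vs => [|v vs [psi rpsi [psi1 psiH psi0]]]; first by exists chi => //; split.
  have [vP|vN] := boolP ((size v == s) && (v != nseq s true)); last first.
    exists psi => //; split=> // om oms omN; rewrite inE => /orP[/eqP omv|].
      by move: vN; rewrite -omv oms eqxx omN.
    exact: psi0.
  move: vP => /andP[/eqP vs_ vN].
  have rv := representable_vertex vs_ (corner_groupV (psiH v vs_ vN)).
  exists (fun om => psi om * (if om == v then (psi v)^-1 else 1))%g.
    exact: representableM.
  split.
  - by rewrite [_ == v]eq_sym (negPf vN) mulg1.
  - move=> om oms omN; apply: corner_groupM; first exact: psiH.
    by case: ifP => _; rewrite ?corner_group1 // corner_groupV ?psiH.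
  - move=> om oms omN; rewrite inE; case: eqP => [->|_] /=; first by rewrite mulgV.
    by move=> omvs; rewrite psi0 // mulg1.
have [psi rpsi [psi1 _ psi0]] := clear [seq val t | t : s.-tuple bool].
rewrite -psi1; apply/corner_groupP; apply: eq_representable rpsi => om oms.
have allE : all id om = (om == nseq s true).
  by rewrite -oms; elim: om {oms} => //= b om ->; rewrite eqseq_cons; case: b.
rewrite /corner allE; case: eqP => [->//|/eqP omN].
apply: psi0 => //; apply/mapP; exists (Tuple (introT eqP oms)) => //.
by rewrite mem_enum.
Qed.

(** Along the cubes [n + |om|], where [|om|] counts the [true] of [om], the
    previous lemma reads as a recurrence of order [s.+1] for [gam] modulo the
    corner group; a finite-state recurrence is eventually periodic. *)
Lemma eventually_periodic_mod_corner_group s :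
  exists q n0, (0 < q)%N /\ forall n, (n0 <= n)%N ->
    ((gam n)^-1 * gam (n + q))%g \in corner_group s.+1.
Proof.
pose win (n : nat) := [ffun j : 'I_s.+1 => gam (n + j)].
have [n1 [n2 [lt12 win12]]] : exists n1 n2, (n1 < n2)%N /\ win n1 = win n2.
  pose f (i : 'I_(#|{ffun 'I_s.+1 -> gT}|.+1)) := win i.
  have /injectivePn [i [j ij fij]] : ~~ injectiveb f.
    apply/injectiveP => /leq_card; rewrite card_ord.
    by rewrite ltnn.
  have : (i < j)%N || (j < i)%N by rewrite -neq_ltn.
  by move=> /orP[lt|lt]; [exists i, j|exists j, i].
(* two equal windows of length [s.+1] agree ever after modulo the corner group *)
exists (n2 - n1)%N, n1; split; first by rewrite subn_gt0.
suff H j : ((gam (n1 + j))^-1 * gam (n2 + j))%g \in corner_group s.+1.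
  move=> n n1n; have := H (n - n1)%N; rewrite subnKC //.
  suff -> : (n2 + (n - n1) = n + (n2 - n1))%N by [].
  by rewrite !addnBA ?(ltnW lt12) // addnC.
elim/ltn_ind: j => j IHj; have [js|sj] := ltnP j s.+1.
  have := congr1 (fun f : {ffun _ -> _} => f (Ordinal js)) win12.
  by rewrite !ffunE /= => ->; rewrite mulVg corner_group1.
pose phi n om := gam (n + count id om).
have rphi n : representable s.+1 (phi n).
  exists (fun i b => if i is 0 then (n + (b : nat))%N else b : nat).
  case=> [|b om] //= _; rewrite /phi /= -addnA; congr (gam (_ + (_ + _))).
  by elim: om => //= c om ->.
have rchi := representableM (representableV (rphi (n1 + (j - s.+1))%N))
                            (rphi (n2 + (j - s.+1))%N).
have := corner_group_top rchi; rewrite /phi count_nseq mul1n -!addnA subnK //.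
apply=> om oms omN; rewrite -!addnA; apply: IHj.
rewrite -[ltnRHS](subnK sj) ltn_add2l ltn_neqAle -{2}oms count_size andbT.
apply: contra omN => /eqP cE; rewrite -{1}oms.
apply/eqP/all_pred1P; rewrite -[all _ _]/(all (pred1 true) om).
by rewrite (eq_all (a2 := id)) ?all_count ?cE ?oms // => -[].
Qed.

Lemma coord_sum_map (Z Y : Type) (h : Z -> Y) (W : nat -> Y -> nat) z :
  coord_sum W (map h z) = coord_sum (fun i x => W i (h x)) z.
Proof. by elim: z W => //= x z IHz W; rewrite (IHz (fun i => W i.+1)). Qed.

(** A single representable system over the alphabet [gT] that carries every
    element of the corner group at once: restricted to the letters [1] and
    [z], it is the cube with [z] at the top vertex and [1] elsewhere. *)
Lemma universal_cube s : exists W : nat -> gT -> nat,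
  (forall z, z \in corner_group s.+1 -> gam (coord_sum W (nseq s.+1 z)) = z) /\
  (forall z om, size om = s.+1 -> om != nseq s.+1 true ->
     gam (coord_sum W [seq if b then z else 1%g | b : bool <- om]) = 1%g).
Proof.
pose fac h (z : seq gT) := corner h (map (pred1 h) z).
pose phi hs z := foldr (fun h acc => fac h z * acc)%g 1%g hs.
have rphi hs : {subset hs <= corner_group s.+1} -> representable s.+1 (phi hs).
  elim: hs => [|h hs IHhs] sub; first exact: representable1.
  apply: representableM; last by apply: IHhs => x xs; rewrite sub ?inE ?xs ?orbT.
  have /corner_groupP [W WP] := sub h (mem_head _ _).
  exists (fun i x => W i (pred1 h x)) => z zs.
  by rewrite -coord_sum_map WP ?size_map.
have [W WP] := rphi (enum (corner_group s.+1)) (fun x => etrans (esym (mem_enum _ x)) \o id).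
exists W; split=> [z zH|z om oms omN].
  rewrite WP ?size_nseq //.
  have facE h : fac h (nseq s.+1 z) = if z == h then h else 1%g.
    rewrite /fac /corner map_nseq /= all_nseq.
    by case: (z == h); rewrite ?orbT //= orbF.
  have : z \in enum (corner_group s.+1) by rewrite mem_enum.
  have phi1 hs : z \notin hs -> phi hs (nseq s.+1 z) = 1%g.
    elim: hs => //= h hs IHhs; rewrite facE inE negb_or => /andP[/negPf-> zhs].
    by rewrite mul1g IHhs.
  elim: (enum _) (enum_uniq (corner_group s.+1)) => //= h hs IHhs /andP[hN uhs].
  rewrite facE inE; case: eqP hN => [<- zN _|_ _ /=]; first by rewrite phi1 ?mulg1.
  by rewrite mul1g; apply: IHhs.
rewrite WP ?size_map //.
elim: (enum _) => //= h hs ->; rewrite mulg1 /fac /corner -map_comp all_map.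
case: ifP => // /allP ha.
have : has negb om.
  rewrite has_predC; apply: contra omN => omT; apply/eqP; rewrite -oms.
  apply/all_pred1P; rewrite (eq_all (a2 := id)) //; by case.
by case/hasP => b /ha /=; case: b => //= /eqP.
Qed.

End Cubes.

(** * Means over functions on a finite set of blocks *)

Section FiniteFunctions.
Variable C : numClosedFieldType.

Lemma mean_prod (I U : finType) (G : I -> U -> C) :
  mean (fun Q : {ffun I -> U} => \prod_t G t (Q t)) = \prod_t mean (G t).
Proof.
rewrite /mean big_split /= bigA_distr_bigA /=; congr (_ * _).
by rewrite prodr_const card_ffun natrX exprVn.
Qed.

Lemma prod_if_card (I : finType) (B : {set I}) (c : C) :
  \prod_t (if t \in B then c else 1) = c ^+ #|B|.
Proof. by rewrite -big_mkcond /= prodr_const. Qed.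

Definition mix (I U : finType) (B : {set I}) (Q Q' : {ffun I -> U}) :
  {ffun I -> U} := [ffun t => if t \in B then Q' t else Q t].

(** Coordinates in [B] and outside [B] may be drawn independently: exchanging
    the [B]-parts of two functions is an involution of the pairs. *)
Lemma mean_mix (I U : finType) (B : {set I}) (Psi : {ffun I -> U} -> C) :
  mean Psi = mean (fun Q => mean (fun Q' => Psi (mix B Q Q'))).
Proof.
rewrite (mean_pair (fun Q Q' => Psi (mix B Q Q'))).
pose sg (u : {ffun I -> U} * {ffun I -> U}) := (mix B u.1 u.2, mix B u.2 u.1).
have sgK : involutive sg.
  by case=> Q Q'; rewrite /sg /=; congr (_, _); apply/ffunP => t; rewrite !ffunE;
     case: (t \in B).
rewrite -[RHS]/(mean ((fun u => Psi u.1) \o sg)) -reindex_mean; last first.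
  exact: inv_bij.
rewrite -(mean_pair (fun Q _ => Psi Q)); apply: eq_mean => Q.
by rewrite mean_cst //; apply/card_gt0P; exists Q.
Qed.

Definition update_at (I U : finType) (Q : {ffun I -> U}) (t : I) (u : U) :
  {ffun I -> U} := [ffun t' => if t' == t then u else Q t'].

(** Resampling one coordinate is again an involution of the pairs. *)
Lemma mean_update_at (I U : finType) (t : I) (Psi : {ffun I -> U} -> C) :
  mean Psi = mean (fun Q => mean (fun u => Psi (update_at Q t u))).
Proof.
rewrite (mean_pair (fun Q u => Psi (update_at Q t u))).
pose sg (v : {ffun I -> U} * U) := (update_at v.1 t v.2, v.1 t).
have sgK : involutive sg.
  case=> Q u; rewrite /sg /= ffunE eqxx; congr (_, _).
  by apply/ffunP => t'; rewrite !ffunE; case: eqP => // ->.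
rewrite -[RHS]/(mean ((fun v => Psi v.1) \o sg)) -reindex_mean; last first.
  exact: inv_bij.
rewrite -(mean_pair (fun Q _ => Psi Q)); apply: eq_mean => Q.
by rewrite mean_cst //; apply/card_gt0P; exists (Q t).
Qed.

(** If resampling a coordinate [t] of [B] within [S] always averages [Xi] to
    zero, then only the functions that avoid [S] on the whole of [B]
    contribute, and these are exponentially rare in [#|B|]. *)
Lemma resampling_bound (I U : finType) (S : {set U}) (B : {set I})
    (Xi : {ffun I -> U} -> C) (M : C) :
  (0 < #|U|)%N -> (forall Q, `|Xi Q| <= M) ->
  (forall t Q, t \in B -> \sum_(u in S) Xi (update_at Q t u) = 0) ->
  `|mean Xi| <= M * (1 - #|S|%:R / #|U|%:R) ^+ #|B|.
Proof.
move=> U_gt0 XiM Xi0.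
pose ok (bs : seq I) (Q : {ffun I -> U}) := all (fun t => Q t \notin S) bs.
have reduce bs : {subset bs <= B} -> mean Xi = mean (fun Q => (ok bs Q)%:R * Xi Q).
  elim: bs => [|t bs IHbs] sub; first by apply: eq_mean => Q; rewrite mul1r.
  have [tB bsB] : t \in B /\ {subset bs <= B}.
    by split=> [|x xbs]; apply: sub; rewrite inE ?eqxx ?xbs ?orbT.
  rewrite IHbs //; apply/eqP; rewrite -subr_eq0 -mulN1r -meanZ -meanD.
  rewrite (@eq_mean _ _ _ (fun Q : {ffun I -> U} => ((Q t \in S) && ok bs Q)%:R * Xi Q)); last first.
    move=> Q /=; rewrite mulN1r -mulrBl; congr (_ * _).
    by case: (Q t \in S); case: (ok bs Q); rewrite /= ?subr0 ?subrr.
  have [tbs|tbs] := boolP (t \in bs).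
    apply/eqP; rewrite (@eq_mean _ _ _ (fun _ => 0 * 0)) ?meanZ ?mul0r // => Q.
    case: andP => [[QtS /allP/(_ t tbs)]|]; first by rewrite QtS.
    by rewrite !mul0r.
  rewrite (mean_update_at t) (@eq_mean _ _ _ (fun _ => 0 * 0)) ?meanZ ?mul0r // => Q.
  have okE u : ok bs (update_at Q t u) = ok bs Q.
    apply: eq_in_all => t' t'bs; rewrite ffunE; case: eqP => // t'E.
    by rewrite -t'E t'bs in tbs.
  rewrite /mean (eq_bigr (fun u => (ok bs Q)%:R *
      (if u \in S then Xi (update_at Q t u) else 0))); last first.
    move=> u _; rewrite ffunE eqxx okE.
    by case: (u \in S); case: (ok bs Q); rewrite /= ?mul1r ?mul0r ?mulr0.
  by rewrite -mulr_sumr -big_mkcond /= Xi0 // !mulr0.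
rewrite (reduce (enum B)); last by move=> t; rewrite mem_enum.
apply: le_trans (norm_mean _) _.
rewrite -prod_if_card.
have -> : \prod_t (if t \in B then 1 - #|S|%:R / #|U|%:R else 1 : C) =
    \prod_t mean (fun u : U => if t \in B then (u \notin S)%:R else 1 : C).
  apply: eq_bigr => t _; case: ifP => _; last by rewrite mean_cst.
  rewrite (@eq_mean _ _ (fun u => (u \notin S)%:R) (fun u => 1 + -1 * (u \in S)%:R)).
    by rewrite meanD meanZ mean_cst // mulN1r /mean -natr_sum -sum1_card big_mkcond mulrC.
  by move=> u; case: (u \in S); rewrite /= mulN1r ?subrr ?subr0.
rewrite -mean_prod -meanZ; apply: ler_mean => Q.
have -> : \prod_t (if t \in B then (Q t \notin S)%:R else 1 : C) =
    (ok (enum B) Q)%:R.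
  rewrite -big_mkcond -big_enum /= /ok; elim: (enum B) => [|t bs IHbs].
    by rewrite big_nil.
  by rewrite big_cons IHbs /= -natrM mulnb.
rewrite normrM normr_nat mulrC ler_wpM2r //.
Qed.

Definition rows (I Z : finType) s (Q : {ffun I -> s.-tuple Z}) :
  s.-tuple {ffun I -> Z} := [tuple [ffun t => tnth (Q t) i] | i < s].

Lemma map_rows (I Z : finType) s (Q : {ffun I -> s.-tuple Z}) t :
  [seq x t | x : {ffun I -> Z} <- rows Q] = Q t.
Proof.
rewrite /= -map_comp -[RHS](map_tnth_enum (Q t)).
by apply: eq_map => i /=; rewrite ffunE.
Qed.

(** A tuple of functions is a function with tuple values. *)
Lemma imean_rows (I Z : finType) s (F : seq {ffun I -> Z} -> C) :
  imean s F = mean (fun Q : {ffun I -> s.-tuple Z} => F (rows Q)).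
Proof.
rewrite imean_tuple (reindex_mean _ (h := @rows I Z s)) //.
exists (fun P : s.-tuple {ffun I -> Z} => [ffun t => [tuple (tnth P i) t | i < s]]).
  by move=> Q; apply/ffunP => t; apply: eq_from_tnth => i;
     rewrite !(ffunE, tnth_mktuple).
move=> P; apply: eq_from_tnth => i; apply/ffunP => t.
by rewrite !(ffunE, tnth_mktuple).
Qed.

Lemma imean_pair_rows (I Z : finType) s
    (F : seq ({ffun I -> Z} * {ffun I -> Z}) -> C) :
  imean s F = mean (fun Q : {ffun I -> s.-tuple (Z * Z)} =>
    F [seq ([ffun t => (q t).1], [ffun t => (q t).2])
      | q : {ffun I -> Z * Z} <- rows Q]).
Proof.
pose h (q : {ffun I -> Z * Z}) : {ffun I -> Z} * {ffun I -> Z} :=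
  ([ffun t => (q t).1], [ffun t => (q t).2]).
rewrite (@imean_map _ _ _ _ h) ?imean_rows //.
exists (fun u : {ffun I -> Z} * {ffun I -> Z} => [ffun t => (u.1 t, u.2 t)]).
  by move=> q; apply/ffunP => t; rewrite !ffunE -surjective_pairing.
by case=> x y; congr (_, _); apply/ffunP => t; rewrite !ffunE.
Qed.

End FiniteFunctions.

(** * Exponential decay over blocks of digits *)

Section Blocks.
Variables (C : numClosedFieldType) (R : idomainType) (chi : R -> C).
Hypothesis chiB : forall x y, chi (x - y) = chi x * (chi y)^*.
Hypothesis chi1 : forall x, `|chi x| = 1.
Variables (k : nat) (k_gt1 : (1 < k)%N) (gT : finGroupType) (gam : nat -> gT).
Hypothesis gam_cut : forall m j n, (n < k ^ j)%N ->
  gam (m * k ^ j + n) = (gam m * gam n)%g.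
Variables (d ell : nat) (W : nat -> gT -> nat).
Let K := (k ^ ell)%N.
Let H := corner_group gam d.+1.
Hypothesis W_lt : forall z, size z = d.+1 -> (coord_sum W z < K)%N.
Hypothesis W_top : forall z, z \in H -> gam (coord_sum W (nseq d.+1 z)) = z.
Hypothesis W_low : forall z om, size om = d.+1 -> om != nseq d.+1 true ->
  gam (coord_sum W [seq if b then z else 1%g | b : bool <- om]) = 1%g.

Lemma sum_digits_lt T (dg : 'I_T -> nat) :
  (forall t, (dg t < K)%N) -> (\sum_(t < T) dg t * K ^ t < K ^ T)%N.
Proof.
elim: T dg => [|T IHT] dg dgK; first by rewrite big_ord0.
rewrite big_ord_recr /= expnSr mulnC.
apply: (@leq_trans (K ^ T + K ^ T * dg ord_max)).
  by rewrite [(K ^ T * _)%N]mulnC ltn_add2r; apply: IHT.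
by rewrite -mulnS leq_mul.
Qed.

(** Seen from one block, the other blocks act by multiplication on both
    sides. *)
Lemma gam_digit T (dg : 'I_T -> nat) (t0 : 'I_T) : (forall t, (dg t < K)%N) ->
  exists A B, [/\ attained gam A, attained gam B & forall dg' : 'I_T -> nat,
    (forall t, (dg' t < K)%N) -> (forall t, t != t0 -> dg' t = dg t) ->
    gam (\sum_(t < T) dg' t * K ^ t) = (A * gam (dg' t0) * B)%g].
Proof.
have cut m T' n : (n < K ^ T')%N -> gam (m * K ^ T' + n) = (gam m * gam n)%g.
  by rewrite -expnM => nK; apply: gam_cut.
elim: T dg t0 => [|T IHT] dg t0 dgK; first by case: t0.
pose lo (dg' : 'I_T.+1 -> nat) t := dg' (widen_ord (leqnSn T) t).
have sumE dg' : (forall t, (dg' t < K)%N) ->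
    gam (\sum_(t < T.+1) dg' t * K ^ t) =
    (gam (dg' ord_max) * gam (\sum_(t < T) lo dg' t * K ^ t))%g.
  move=> dgK'; rewrite big_ord_recr /= addnC cut //.
  by apply: sum_digits_lt => t; apply: dgK'.
have [lt0|] := ltnP t0 T; last first.
  rewrite leq_eqVlt [in X in _ || X]ltnNge -ltnS ltn_ord orbF => /eqP t0E.
  have {t0E} -> : t0 = ord_max by apply: val_inj.
  exists 1%g, (gam (\sum_(t < T) lo dg t * K ^ t)); split.
  - exact: (attained1 gam_cut).
  - by eexists.
  move=> dg' dgK' E; rewrite sumE // mul1g; congr (_ * gam _)%g.
  apply: eq_bigr => t _; congr (_ * _)%N; apply: E.
  by rewrite -val_eqE /= neq_ltn ltn_ord.
have t0E : t0 = widen_ord (leqnSn T) (Ordinal lt0) by apply: val_inj.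
have [A [B [aA aB AB]]] := IHT (lo dg) (Ordinal lt0) (fun t => dgK _).
exists (gam (dg ord_max) * A)%g, B; split=> //.
  by apply: (attainedM k_gt1 gam_cut) => //; eexists.
move=> dg' dgK' E; rewrite sumE // AB => [|t|t tt0].
- rewrite (E ord_max); first by rewrite !mulgA /lo -t0E.
  by rewrite -val_eqE /= neq_ltn lt0 orbT.
- exact: dgK'.
- by apply: E; rewrite t0E -val_eqE.
Qed.

Variables (f : gT -> C) (M : C).
Hypothesis f_le : forall x, `|f x| <= M.
Hypothesis f_sum0 : forall x, attained gam x -> \sum_(h in H) f (x * h)%g = 0.

(** The corner group is normalised by the attained elements, so [f] also
    sums to zero over the double translates of it. *)
Lemma f_sum0_conj A B : attained gam A -> attained gam B ->
  \sum_(h in H) f (A * h * B)%g = 0.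
Proof.
move=> aA aB; rewrite -[RHS](f_sum0 (attainedM k_gt1 gam_cut aA aB)).
rewrite (reindex_inj (conjg_inj (B^-1)%g)); apply: eq_big => [h|h _].
  apply/idP/idP => hH; last first.
    by rewrite conjgE invgK mulgA; apply: (corner_groupJ k_gt1 gam_cut).
  have := corner_groupJ k_gt1 gam_cut (attainedV k_gt1 gam_cut aB) hH.
  by rewrite conjgE !invgK !mulgA mulVg mul1g mulgKV.
by rewrite conjgE invgK !mulgA mulgKV.
Qed.

Section Pattern.
Variables (T : nat) (B : {set 'I_T}) (c : 'I_T -> nat).
Hypothesis c_lt : forall t, (c t < K)%N.

Let X := {ffun 'I_T -> gT}.

(** Blocks in [B] are filled by the cube [W], the others are frozen. All
    carries of the cube happen inside the blocks. *)
Definition block_digits (l : seq X) (t : 'I_T) : nat :=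
  if t \in B then coord_sum W [seq x t | x : X <- l] else c t.

Definition block_value (l : seq X) : nat := (\sum_(t < T) block_digits l t * K ^ t)%N.

Let V (i : nat) (x : X) : nat := (\sum_(t in B) W i (x t) * K ^ t)%N.

Lemma block_value_coord_sum l :
  block_value l = (coord_sum V l + \sum_(t | t \notin B) c t * K ^ t)%N.
Proof.
rewrite /block_value (bigID (mem B)) /=; congr (_ + _)%N; last first.
  by apply: eq_bigr => t tB; rewrite /block_digits (negPf tB).
rewrite (eq_bigr (fun t => coord_sum W [seq x t | x : X <- l] * K ^ t)%N); last first.
  by move=> t tB; rewrite /block_digits tB.
rewrite /V; elim: l W => [|x l IHl] W' /=; first by rewrite big1.
under eq_bigr do rewrite mulnDl.
by rewrite big_split /= (IHl (fun i => W' i.+1)).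
Qed.

Lemma vertex_rows om (Q : {ffun 'I_T -> d.+1.-tuple (gT * gT)}) t :
  [seq x t | x : X <- vertex om [seq ([ffun t => (q t).1], [ffun t => (q t).2])
      | q : {ffun 'I_T -> gT * gT} <- rows Q]] = vertex om (Q t).
Proof.
rewrite -(map_rows Q t) /vertex; elim: (tval (rows Q)) om => [|q l IHl] [|b om] //=.
by rewrite IHl; case: b; rewrite ffunE // -surjective_pairing.
Qed.

Let vertex_value (Q : {ffun 'I_T -> d.+1.-tuple (gT * gT)}) (om : seq bool) :=
  (\sum_(t < T)
    (if t \in B then coord_sum W (vertex om (Q t)) else c t) * K ^ t)%N.

(** With the pair [(1, z)] in every coordinate, a block carries the cube with
    [z] at the top vertex and [1] elsewhere. *)
Let refresh (z : gT) : d.+1.-tuple (gT * gT) := [tuple of nseq d.+1 (1%g, z)].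

Lemma vertex_refresh om z : size om = d.+1 ->
  vertex om (refresh z) = [seq if b then z else 1%g | b : bool <- om].
Proof.
rewrite -[tval _]/(nseq d.+1 (1%g, z)).
elim: d.+1 om => [|n IHn] [|b om] //= [/IHn].
by rewrite /vertex /= => ->.
Qed.

Lemma refresh_inj : injective refresh.
Proof. by move=> z z' /(congr1 (fun t => tval t)) /= []. Qed.

(** Resampling the top vertex of one cube over the corner group averages
    [f] to zero there and does not affect the other vertices. *)
Lemma refresh_sum0 (t0 : 'I_T) (Q : {ffun 'I_T -> d.+1.-tuple (gT * gT)}) :
  t0 \in B ->
  \sum_(u in [set refresh z | z in H]%SET)
     cube_prod d.+1 (fun om => f (gam (vertex_value (update_at Q t0 u) om))) = 0.
Proof.
move=> t0B; rewrite big_imset /=; last by move=> z z' _ _; apply: refresh_inj.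
have split om : size om = d.+1 -> exists A A',
    [/\ attained gam A, attained gam A' & forall z,
      gam (vertex_value (update_at Q t0 (refresh z)) om) =
      (A * gam (coord_sum W [seq if b then z else 1%g | b : bool <- om]) * A')%g].
  move=> oms.
  pose dg z t := if t \in B then coord_sum W (vertex om (update_at Q t0 (refresh z) t)) else c t.
  have dgK z t : (dg z t < K)%N.
    rewrite /dg; case: ifP => // _; apply: W_lt.
    by rewrite /vertex size_map size_zip size_tuple oms minnn.
  have [A [A' [aA aA' E]]] := gam_digit t0 (dgK 1%g).
  exists A, A'; split=> // z; rewrite /vertex_value (E (dg z)) //.
    by rewrite /dg t0B ffunE eqxx vertex_refresh.
  by move=> t tt0; rewrite /dg !ffunE (negPf tt0).
apply: (@cube_prod_sum0 _ _ H d.+1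
  (fun z om => f (gam (vertex_value (update_at Q t0 (refresh z)) om)))) => [om oms omN z z' _ _|].
  have [A [A' [_ _ E]]] := split om oms.
  by rewrite !E !W_low.
have [A [A' [aA aA' E]]] := split (nseq d.+1 true) (size_nseq _ _).
rewrite -[RHS](f_sum0_conj aA aA'); apply: eq_bigr => z zH.
by rewrite E map_nseq W_top.
Qed.

(** The probability that random pairs of letters form [refresh z] for some [z]
    in the corner group. *)
Definition refresh_rate : C := #|H|%:R / #|{: d.+1.-tuple (gT * gT)}|%:R.

Lemma refresh_rate_gt0 : 0 < refresh_rate.
Proof.
rewrite divr_gt0 // ltr0n; last by apply/card_gt0P; exists (refresh 1%g).
by apply/card_gt0P; exists 1%g; apply: (corner_group1 gam_cut).
Qed.

Lemma refresh_rate_le1 : refresh_rate <= 1.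
Proof.
have U0 : 0 < #|{: d.+1.-tuple (gT * gT)}|%:R :> C.
  by rewrite ltr0n; apply/card_gt0P; exists (refresh 1%g).
by rewrite ler_pdivrMr // mul1r ler_nat -(card_imset H refresh_inj) max_card.
Qed.

(** Gowers-Cauchy-Schwarz removes the phase and leaves random cubes in the
    blocks of [B]; a single refreshed block makes the expectation vanish, so
    only the event that no block is refreshed contributes. *)
Lemma pattern_bound (p : {poly R}) : (size p <= d.+1)%N ->
  `|imean d.+1 (fun l => f (gam (block_value l)) * chi p.[(block_value l)%:R])|
    ^+ (2 ^ d.+1) <= M ^+ (2 ^ d.+1) * (1 - refresh_rate) ^+ #|B|.
Proof.
move=> sp; set nc := (\sum_(t | t \notin B) c t * K ^ t)%N.
pose q := p \Po ('X + nc%:R%:P).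
have sq : (size q <= d.+1)%N by rewrite size_comp_poly2 // size_XaddC.
rewrite (@eq_imean _ _ _ _
    (fun l => f (gam (block_value l)) * chi q.[(coord_sum V l)%:R])); last first.
  by move=> l _; rewrite /q horner_comp !hornerE -natrD -block_value_coord_sum.
have := gowers_cauchy_schwarz chiB chi1 (fun l => f (gam (block_value l))) V sq.
set lhs := `|_| ^+ _ => gcs; have lhs0 : 0 <= lhs by rewrite exprn_ge0.
apply: (le_trans gcs); move: gcs; set m := imean _ _ => gcs.
apply: (@le_trans _ _ `|m|).
  exact/real_ler_norm/ger0_real/(le_trans lhs0).
rewrite /m imean_pair_rows.
rewrite (@eq_mean _ _ _ (fun Q => cube_prod d.+1 (fun om => f (gam (vertex_value Q om))))); last first.
  move=> Q; apply: eq_cube_prod => om _; congr (f (gam _)).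
  by apply: eq_bigr => t _; rewrite /block_digits vertex_rows.
rewrite /refresh_rate -(card_imset H refresh_inj).
apply: resampling_bound => [||t Q tB].
- by apply/card_gt0P; exists (refresh 1%g).
- by move=> Q; apply: norm_cube_prod_le.
- exact: refresh_sum0.
Qed.

End Pattern.

Lemma sum_digits_inj T (dg dg' : 'I_T -> nat) :
  (forall t, (dg t < K)%N) -> (forall t, (dg' t < K)%N) ->
  (\sum_(t < T) dg t * K ^ t = \sum_(t < T) dg' t * K ^ t)%N -> dg =1 dg'.
Proof.
elim: T dg dg' => [|T IHT] dg dg' dgK dgK'; first by move=> _ [].
rewrite !big_ord_recr /=; set S := (\sum_(t < T) _)%N; set S' := (\sum_(t < T) _)%N.
have SK : (S < K ^ T)%N by apply: sum_digits_lt => t; apply: dgK.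
have SK' : (S' < K ^ T)%N by apply: sum_digits_lt => t; apply: dgK'.
have KT : (0 < K ^ T)%N by apply: leq_ltn_trans SK.
rewrite ![(_ + _ * K ^ T)%N]addnC => E.
have E1 : dg ord_max = dg' ord_max.
  by move: (congr1 (fun n => n %/ K ^ T)%N E); rewrite !divnMDl // !divn_small // !addn0.
have E2 : S = S' by move: (congr1 (fun n => n %% K ^ T)%N E); rewrite !modnMDl !modn_small.
move=> t; have [tT|] := ltnP t T.
  have -> : t = widen_ord (leqnSn T) (Ordinal tT) by apply: val_inj.
  exact: (IHT (fun i => dg (widen_ord _ i)) (fun i => dg' (widen_ord _ i))).
rewrite leq_eqVlt [in X in _ || X]ltnNge -ltnS ltn_ord orbF => /eqP tE.
by have -> : t = ord_max by apply: val_inj.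
Qed.

Variable rho : C.
Hypothesis rho_ge0 : 0 <= rho.
Hypothesis rho_rate : 1 - refresh_rate <= rho ^+ (2 ^ d.+1).

(** Composing a block with the transposition of [0] and a random value of the
    cube [W] does not change the mean, and turns the block value [0] into that
    random value. For fixed [y] the blocks with [y t = 0] then contribute a
    factor [rho] each, and averaging over [y] gives a factor less than [1] per
    block. *)
Lemma block_mean_bound T (p : {poly R}) : (size p <= d.+1)%N ->
  `|mean (fun n : 'I_(K ^ T) => f (gam n) * chi p.[n%:R])|
    <= M * ((K%:R - 1 + rho) / K%:R) ^+ T.
Proof.
move=> sp.
have K0 : (0 < K)%N by rewrite expn_gt0 ltnW.
have M0 : 0 <= M by apply: le_trans (f_le 1%g).
pose z0 : 'I_K := Ordinal K0.
pose G n := f (gam n) * chi p.[n%:R].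
pose num (y : {ffun 'I_T -> 'I_K}) := (\sum_(t < T) y t * K ^ t)%N.
have numK y : (num y < K ^ T)%N by apply: sum_digits_lt => t.
pose h y := Ordinal (numK y).
have bij_h : bijective h.
  apply: inj_card_bij; last by rewrite card_ffun !card_ord.
  move=> y y' /(congr1 val) /= /sum_digits_inj E.
  by apply/ffunP => t; apply: val_inj; apply: E.
rewrite (reindex_mean _ bij_h) -[mean _]/(mean (fun y => G (num y))).
pose cv (e : d.+1.-tuple gT) : 'I_K := Ordinal (W_lt (size_tuple e)).
pose sg (e : {ffun 'I_T -> d.+1.-tuple gT}) (y : {ffun 'I_T -> 'I_K}) :=
  [ffun t => tperm z0 (cv (e t)) (y t)].
have sgK e : involutive (sg e).
  by move=> y; apply/ffunP => t; rewrite !ffunE tpermK.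
have E_gt0 : (0 < #|{ffun 'I_T -> d.+1.-tuple gT}|)%N.
  by apply/card_gt0P; exists [ffun => [tuple of nseq d.+1 1%g]].
have -> : mean (fun y => G (num y)) =
    mean (fun y => mean (fun e => G (num (sg e y)))).
  rewrite -mean_exchange -[LHS](mean_cst _ E_gt0); apply: eq_mean => e.
  by rewrite (reindex_mean _ (inv_bij (sgK e))).
have bound y : `|mean (fun e => G (num (sg e y)))|
    <= M * \prod_t (if y t == z0 then rho else 1).
  pose B := finset (fun t => y t == z0).
  have -> : \prod_t (if y t == z0 then rho else 1) = rho ^+ #|B|.
    by rewrite -prod_if_card; apply: eq_bigr => t _; rewrite inE.
  (* freeze the cube letters outside [B], where they only select block values *)
  rewrite (mean_mix B); apply: le_trans (norm_mean _) _.
  rewrite -[leRHS](mean_cst _ E_gt0); apply: ler_mean => e.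
  pose c (t : 'I_T) : nat := tperm z0 (cv (e t)) (y t).
  have cK t : (c t < K)%N by exact: ltn_ord.
  have -> : mean (fun e' => G (num (sg (mix B e e') y))) =
      imean d.+1 (fun l => G (block_value B c l)).
    rewrite imean_rows; apply: eq_mean => e'; congr G.
    apply: eq_bigr => t _; rewrite !ffunE /block_digits map_rows inE.
    by case: eqP => // ->; rewrite tpermL.
  have N0 : (0 < 2 ^ d.+1)%N by rewrite expn_gt0.
  rewrite -(ler_pXn2r N0) ?nnegrE ?mulr_ge0 ?exprn_ge0 //.
  apply: le_trans (pattern_bound B cK sp) _.
  rewrite exprMn ler_wpM2l ?exprn_ge0 // exprAC.
  by rewrite lerXn2r ?nnegrE ?exprn_ge0 // subr_ge0 refresh_rate_le1.
apply: le_trans (norm_mean _) _; apply: le_trans (ler_mean bound) _.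
rewrite meanZ (mean_prod (fun _ (a : 'I_K) => if a == z0 then rho else 1)).
rewrite prodr_const card_ord.
have -> : mean (fun a : 'I_K => if a == z0 then rho else 1) =
    (K%:R - 1 + rho) / K%:R.
  rewrite /mean card_ord mulrC (bigD1 z0) //=.
  rewrite (eq_bigr (fun _ => 1)) => [|a /negPf-> //].
  by rewrite sumr_const cardC1 card_ord -subn1 natrB // addrC.
by [].
Qed.

End Blocks.

(** Bernoulli's inequality: [1 - rate / 2 ^ s] serves as a [2 ^ s]-th root of
    the decay rate [1 - rate]. *)
Lemma bernoulli_root (C : numDomainType) (x : C) n : 0 <= x <= 1 ->
  1 - x *+ n <= (1 - x) ^+ n.
Proof.
move=> /andP[x0 x1]; elim: n => [|n IHn]; first by rewrite mulr0n subr0 expr0.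
rewrite exprS.
apply: (@le_trans _ _ ((1 - x) * (1 - x *+ n))); last by rewrite ler_wpM2l // subr_ge0.
have -> : (1 - x) * (1 - x *+ n) = 1 - x *+ n.+1 + x * (x *+ n).
  rewrite mulrS opprD mulrBl mul1r mulrBr mulr1 opprB !addrA addrAC.
  by congr (_ + _); rewrite addrAC.
by rewrite lerDl mulr_ge0 // mulrn_wge0.
Qed.

(** * Power saving for corner-free functions *)

Section LongSums.
Variables (C : numClosedFieldType) (R : idomainType) (chi : R -> C).
Hypothesis chiB : forall x y, chi (x - y) = chi x * (chi y)^*.
Hypothesis chi1 : forall x, `|chi x| = 1.
Variables (k : nat) (k_gt1 : (1 < k)%N) (gT : finGroupType) (gam : nat -> gT).
Hypothesis gam_cut : forall m j n, (n < k ^ j)%N ->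
  gam (m * k ^ j + n) = (gam m * gam n)%g.
Variable d : nat.

(** The [x] range over attained values only: these are what [gam] visits, and
    total balance gives no information about [f] elsewhere. *)
Definition corner_free (f : gT -> C) : Prop := forall x, attained gam x ->
  \sum_(h in corner_group gam d.+1) f (x * h)%g = 0.

Lemma corner_free_translate f m : corner_free f ->
  corner_free (fun x => f (gam m * x)%g).
Proof.
move=> f0 x ax; under eq_bigr do rewrite mulgA.
by apply/f0/(attainedM k_gt1 gam_cut) => //; exists m.
Qed.

(** With blocks of [ell] digits, [eta] is the mean over one block value of
    [rho] at [0] and [1] elsewhere. Since [eta ^+ T] is at least the inverse of the
    number of integers with [T] blocks, an incomplete stretch of them can be
    absorbed in the bound. *)
Lemma power_block_saving : exists ell (eta : C),
  [/\ (0 < ell)%N, (k ^ ell)%:R^-1 <= eta, eta < 1 &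
  forall (f : gT -> C) (M : C), (forall x, `|f x| <= M) -> corner_free f ->
  forall T (p : {poly R}), (size p <= d.+1)%N ->
  `|\sum_(n < (k ^ ell) ^ T) f (gam n) * chi p.[n%:R]|
    <= M * eta ^+ T * ((k ^ ell) ^ T)%:R].
Proof.
have [W [W_top W_low]] := universal_cube k_gt1 gam_cut d.
have [j W_lt] := coord_sum_bounded k_gt1 d.+1 W.
pose rate : C := refresh_rate C gam d.
have rate_gt0 : 0 < rate := refresh_rate_gt0 C gam_cut d.
have rate_le1 : rate <= 1 := refresh_rate_le1 C gam d.
have N0 : 0 < (2 ^ d.+1)%:R :> C by rewrite ltr0n expn_gt0.
pose rho := 1 - rate / (2 ^ d.+1)%:R.
have q_ge0 : 0 <= rate / (2 ^ d.+1)%:R by rewrite divr_ge0 // ltW.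
have q_le1 : rate / (2 ^ d.+1)%:R <= 1.
  by rewrite ler_pdivrMr // mul1r (le_trans rate_le1) // ler1n expn_gt0.
have rho_ge0 : 0 <= rho by rewrite subr_ge0.
have rho_rate : 1 - rate <= rho ^+ (2 ^ d.+1).
  apply: le_trans (bernoulli_root _ _); last by rewrite q_ge0 q_le1.
  by rewrite -[_ / _ *+ _]mulr_natr divfK // gt_eqF.
pose K := (k ^ j.+1)%N.
have K_gt1 : (1 < K)%N by apply: leq_trans k_gt1 _; rewrite -{1}(expn1 k) leq_pexp2l // ltnW.
have K0 : 0 < K%:R :> C by rewrite ltr0n ltnW.
exists j.+1, ((K%:R - 1 + rho) / K%:R); split=> //.
- rewrite -[leLHS]mul1r ler_pM2r ?invr_gt0 // -[leLHS]addr0 lerD //.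
  by rewrite lerBrDr -[leLHS]/(2%:R : C) ler_nat.
- rewrite ltr_pdivrMr // mul1r /rho addrA subrK.
  by rewrite gtrDl oppr_lt0 divr_gt0.
move=> f M fM f0 T p sp.
have W_lt' z : size z = d.+1 -> (coord_sum W z < k ^ j.+1)%N.
  by move=> /W_lt/leq_trans; apply; rewrite leq_pexp2l // ltnW.
have := block_mean_bound chiB chi1 k_gt1 gam_cut W_lt' W_top W_low fM f0
  rho_ge0 rho_rate T sp.
rewrite /mean card_ord normrM normfV normr_nat mulrC ler_pdivrMr //.
by rewrite ltr0n !expn_gt0 ltnW // ltnW.
Qed.

(** An interval of integers is a union of aligned blocks, on which [gam] is a
    translate of itself, up to one incomplete block. *)
Lemma interval_bound (f : gT -> C) (M B : C) (p : {poly R}) Q N :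
  (exists T, Q = k ^ T)%N ->
  (forall x, `|f x| <= M) -> corner_free f -> (size p <= d.+1)%N ->
  (forall f' (p' : {poly R}), (forall x, `|f' x| <= M) -> corner_free f' ->
     (size p' <= d.+1)%N ->
     `|\sum_(n < Q) f' (gam n) * chi p'.[n%:R]| <= B) ->
  `|\sum_(n < N) f (gam n) * chi p.[n%:R]| <= B * (N %/ Q)%:R + M * Q%:R.
Proof.
move=> [T QE] fM f0 sp blockB.
have Q0 : (0 < Q)%N by rewrite QE expn_gt0 ltnW.
have cutQ m n : (n < Q)%N -> gam (m * Q + n) = (gam m * gam n)%g.
  by rewrite QE; apply: gam_cut.
have whole m : `|\sum_(n < m * Q) f (gam n) * chi p.[n%:R]| <= B * m%:R.
  elim: m => [|m IHm]; first by rewrite mul0n big_ord0 normr0 mulr0.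
  rewrite mulSnr big_split_ord /= -natr1 mulrDr mulr1.
  apply: le_trans (ler_normD _ _) _; apply: lerD => //.
  pose p' := p \Po ('X + (m * Q)%:R%:P).
  have sp' : (size p' <= d.+1)%N by rewrite size_comp_poly2 // size_XaddC.
  have := blockB _ p' _ (corner_free_translate m f0) sp' => /(_ (fun _ => fM _)).
  apply: le_trans; rewrite le_eqVlt; apply/orP; left; apply/eqP; congr `|_|.
  apply: eq_bigr => n _; rewrite cutQ //; congr (_ * chi _).
  by rewrite /p' horner_comp !hornerE natrD addrC.
have -> : \sum_(n < N) f (gam n) * chi p.[n%:R] =
    \sum_(n < N %/ Q * Q + N %% Q) f (gam n) * chi p.[n%:R] by rewrite -divn_eq.
rewrite big_split_ord /=.
apply: le_trans (ler_normD _ _) _; apply: lerD; first exact: whole.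
apply: le_trans (ler_norm_sum _ _ _) _.
apply: (@le_trans _ _ (\sum_(n < N %% Q) M)).
  by apply: ler_sum => n _; rewrite normrM chi1 mulr1.
rewrite sumr_const card_ord -[M *+ _]mulr_natr ler_wpM2l ?ler_nat 1?ltnW ?ltn_mod //.
by apply: le_trans (fM 1%g).
Qed.

(** With [K] the square of the block base, [trunc_log K N] is the number of
    blocks in about half of the digits of [N]. *)
Theorem long_sum_saving : exists K (eta : C),
  [/\ (1 < K)%N, 0 < eta, eta < 1 &
  forall (f : gT -> C) (M : C), (forall x, `|f x| <= M) -> corner_free f ->
  forall N (p : {poly R}), (0 < N)%N -> (size p <= d.+1)%N ->
  `|\sum_(n < N) f (gam n) * chi p.[n%:R]|
    <= M *+ 2 * N%:R * eta ^+ trunc_log K N].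
Proof.
have [ell [eta [ell0 etaK eta1 saving]]] := power_block_saving.
pose K := (k ^ ell)%N.
have K_gt1 : (1 < K)%N by rewrite -(exp1n ell) ltn_exp2r.
have K0 : 0 < K%:R :> C by rewrite ltr0n ltnW.
have eta0 : 0 < eta by apply: lt_le_trans etaK; rewrite invr_gt0.
have K2_gt1 : (1 < K ^ 2)%N by rewrite -(exp1n 2) ltn_exp2r.
exists (K ^ 2)%N, eta; split=> // f M fM f0 N p N0 sp.
set T := trunc_log _ _; have /andP[KTN _] := trunc_log_bounds K2_gt1 N0.
have M0 : 0 <= M by apply: le_trans (fM 1%g).
have KTQ : (K ^ T = k ^ (ell * T))%N by rewrite expnM.
have := @interval_bound f M (M * eta ^+ T * (K ^ T)%:R) p (K ^ T) N
  (ex_intro _ _ KTQ) fM f0 sp (fun f' p' f'M f'0 => saving f' M f'M f'0 T p').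
move/le_trans; apply; rewrite mulr2n mulrDl mulrDl; apply: lerD.
  rewrite -!mulrA ler_wpM2l // [leRHS]mulrC ler_wpM2l ?(exprn_ge0 _ (ltW eta0)) //.
  by rewrite -natrM ler_nat mulnC leq_trunc_div.
rewrite -mulrA ler_wpM2l //.
(* since [K ^ (2 * T) <= N], the incomplete block is shorter than [N / K ^ T] *)
apply: (@le_trans _ _ (N%:R * K%:R^-1 ^+ T)).
  rewrite exprVn ler_pdivlMr ?exprn_gt0 // -natrX -natrM ler_nat.
  by rewrite -expnD addnn -mul2n expnM.
by rewrite ler_wpM2l // lerXn2r ?nnegrE ?invr_ge0 ?(ltW eta0) ?(ltW K0).
Qed.

End LongSums.

(** * Characters and limits *)

Section Analysis.
Variable R : realType.
Local Open Scope complex_scope.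
Local Open Scope classical_set_scope.

Lemma e_sub (x y : R) : e (x - y) = e x * (e y)^*.
Proof.
rewrite /e mulrBr cosB sinB; apply/eqP; rewrite eq_complex /=.
by rewrite !mulrN opprK eqxx /= eq_sym addrC.
Qed.

Lemma norm_e (x : R) : `|e x| = 1.
Proof. by rewrite normc_def /= cos2Dsin2 sqrtr1. Qed.

Definition vanishes (u : nat -> R[i]) : Prop :=
  forall eps : R, 0 < eps -> exists N0, forall n, (N0 <= n)%N -> `|u n| <= eps%:C.

Lemma vanishes_cvg (u : nat -> R[i]) :
  u n @[n --> \oo] --> (0 : R[i]^o) -> vanishes u.
Proof.
move=> u0 eps e0; have e0' : 0 < eps%:C by rewrite ltcR.
have [N0 _ HN] := @cvgr0_norm_le _ (R[i]^o) _ _ _ _ u0 _ e0'.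
by exists N0 => n; exact: HN.
Qed.

Lemma vanishesD (u v : nat -> R[i]) :
  vanishes u -> vanishes v -> vanishes (fun n => u n + v n).
Proof.
move=> u0 v0 eps e0; have e2 : 0 < eps / 2 by rewrite divr_gt0.
have [N1 H1] := u0 _ e2; have [N2 H2] := v0 _ e2.
exists (maxn N1 N2) => n; rewrite geq_max => /andP[n1 n2].
apply: le_trans (ler_normD _ _) _; rewrite [eps]splitr rmorphD /=.
by apply: lerD; [exact: H1|exact: H2].
Qed.

Lemma vanishes_le (c : R) (u v : nat -> R[i]) :
  vanishes u -> (forall n, (0 < n)%N -> `|v n| <= c%:C * `|u n|) -> vanishes v.
Proof.
move=> u0 vu eps e0; have c1 : 0 < `|c| + 1 by rewrite ltr_wpDl.
have [N0 HN] := u0 (eps / (`|c| + 1)) (divr_gt0 e0 c1).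
exists N0.+1 => n Nn; apply: le_trans (vu n (leq_ltn_trans (leq0n _) Nn)) _.
apply: (@le_trans _ _ ((`|c| + 1)%:C * (eps / (`|c| + 1))%:C)).
  apply: (@le_trans _ _ ((`|c| + 1)%:C * `|u n|)).
    by rewrite ler_wpM2r // lecR (le_trans (ler_norm c)) // lerDl.
  by rewrite ler_wpM2l ?HN 1?ltnW // lecR ltW.
by rewrite -rmorphM /= mulrCA divff ?gt_eqF // mulr1.
Qed.

Lemma vanishesZ (a : R[i]) (u : nat -> R[i]) :
  vanishes u -> vanishes (fun n => a * u n).
Proof.
move=> u0; apply: (@vanishes_le (Normc.normc a) u) => // n _.
by rewrite normrM.
Qed.

Lemma vanishes_sum (I : finType) (u : I -> nat -> R[i]) :
  (forall i, vanishes (u i)) -> vanishes (fun n => \sum_i u i n).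
Proof.
move=> u0; elim: (index_enum I) => [|i s IHs].
  by move=> eps e0; exists 0 => n _; rewrite big_nil normr0 lecR ltW.
by move=> eps e0; have [N0 HN] := vanishesD (u0 i) IHs e0;
   exists N0 => n Nn; rewrite big_cons HN.
Qed.

Lemma vanishes_cst (a : R[i]) : vanishes (fun _ => a) -> a = 0.
Proof.
move=> a0; apply/eqP; rewrite -normr_eq0; apply/contraT => aN0.
have n0 : 0 < Normc.normc a by rewrite -ltcR lt_def aN0 (normr_ge0 a).
have [N0 /(_ N0 (leqnn _))] := a0 _ (divr_gt0 n0 (ltr0n _ 2)).
by rewrite -[`|a|]/((Normc.normc a)%:C) lecR ler_pdivlMr // mulrDr mulr1 gerDl leNgt n0.
Qed.

Lemma vanishes_geometric (K : nat) (h : R) : (1 < K)%N -> 0 <= h < 1 ->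
  vanishes (fun n => (h ^+ trunc_log K n)%:C).
Proof.
move=> K1 /andP[h0 h1] eps e0.
have hn : `|h| < 1 by rewrite ger0_norm.
have [n0 _ H] := cvgr0_norm_le _ (cvg_expr hn) _ e0.
exists (K ^ n0)%N => n Kn; rewrite ger0_norm ?lecR ?exprn_ge0 //.
apply: (@le_trans _ _ (h ^+ n0)); last first.
  by have := H n0 (leqnn _); rewrite ger0_norm // exprn_ge0.
by apply: (ler_wiXn2l h0 (ltW h1)); apply: trunc_log_max.
Qed.

Lemma vanishes_inv (a : R[i]) : vanishes (fun n => n%:R^-1 * a).
Proof.
move=> eps e0.
have [N0 HN] : exists N0 : nat, Normc.normc a / eps < N0%:R.
  exists (Num.truncn (Normc.normc a / eps)).+1; exact: truncnS_gt.
have a0 : 0 <= Normc.normc a by rewrite -lecR (normr_ge0 a).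
exists N0 => n Nn; rewrite normrM normfV normr_nat.
have n_gt0 : 0 < n%:R :> R.
  by rewrite (le_lt_trans _ (lt_le_trans HN _)) ?ler_nat // divr_ge0 // ltW.
rewrite mulrC ler_pdivrMr; last by rewrite ltr0n -(ltr0n R).
rewrite -[`|a|]/((Normc.normc a)%:C) -(rmorph_nat (real_complex R)) -rmorphM lecR.
rewrite mulrC -ler_pdivrMr // (le_trans (ltW HN)) // ler_nat //.
Qed.

(** A geometric decay in the number of digits of [N] is a power of [N]; the
    factor [h^-1] pays for rounding the number of digits. *)
Lemma geometric_power_saving (K N : nat) (h : R) :
  (1 < K)%N -> 0 < h < 1 -> (0 < N)%N ->
  h ^+ trunc_log K N <= h^-1 * N%:R `^ (- - (ln h / ln K%:R)).
Proof.
move=> K1 /andP[h0 h1] N0; set T := trunc_log K N.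
have /andP[_ NK] := trunc_log_bounds K1 N0.
have N0' : 0 < N%:R :> R by rewrite ltr0n.
have K0' : 0 < K%:R :> R by rewrite ltr0n ltnW.
have lnK0 : 0 < ln K%:R :> R by rewrite ln_gt0 // ltr1n.
have lnh : ln h < 0 by rewrite ln_lt0 // h0 h1.
rewrite mulrC ler_pdivlMr // -exprSr opprK /powR gt_eqF //.
rewrite -{1}[h]lnK ?posrE // -expRM_natl ler_expR.
rewrite -mulrA mulrC ler_nM2l // mulrC ler_pdivrMr // mulr_natl -lnXn //.
by rewrite ler_ln ?posrE ?exprn_gt0 // -natrX ler_nat ltnW.
Qed.

End Analysis.

(** * Total balance forces corner-freeness *)

Section ZeroMean.
Variables (R : realType) (k : nat) (k_gt1 : (1 < k)%N).
Variables (gT : finGroupType) (gam : nat -> gT).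
Hypothesis gam_cut : forall m j n, (n < k ^ j)%N ->
  gam (m * k ^ j + n) = (gam m * gam n)%g.
Variable d : nat.
Let H := corner_group gam d.+1.
Local Open Scope complex_scope.

(** Every attained value is attained again arbitrarily far, behind a nonzero
    prefix of value [1]. *)
Lemma gam_recurrent n n0 : exists2 n', (n0 <= n')%N & gam n' = gam n.
Proof.
have [m gm] := attainedV k_gt1 gam_cut (ex_intro _ 1%N erefl : attained gam (gam 1)).
pose u := (1 * k ^ m + m)%N.
have u1 : gam u = 1%g by rewrite /u (gam_cut 1 (ltn_expl m k_gt1)) gm mulgV.
exists (u * k ^ (n + n0) + n)%N; last first.
  have nk : (n < k ^ (n + n0))%N.
    exact: leq_ltn_trans (leq_addr n0 n) (ltn_expl _ k_gt1).
  by rewrite (gam_cut u nk) u1 mul1g.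
apply: (@leq_trans (k ^ (n + n0))).
  by rewrite (leq_trans (leq_addl n n0)) // ltnW // ltn_expl.
apply: leq_trans (leq_addr _ _); rewrite leq_pmull // /u mul1n addn_gt0.
by rewrite expn_gt0 ltnW.
Qed.

Lemma mem_corner_groupM h h' : h \in H -> ((h * h')%g \in H) = (h' \in H).
Proof.
move=> hH; apply/idP/idP => h'H; last exact: (corner_groupM k_gt1 gam_cut).
rewrite -[h'](mulKg h); apply: (corner_groupM k_gt1 gam_cut) => //.
exact: (corner_groupV k_gt1 gam_cut).
Qed.

Lemma mean_free_vanishes (G : gT -> R[i]) : corner_free gam d G ->
  vanishes (fun N => N%:R^-1 * \sum_(n < N) G (gam n)).
Proof.
have [K [eta [K1 eta0 eta1 saving]]] :=
  long_sum_saving (@e_sub R) (@norm_e R) k_gt1 gam_cut d.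
move=> G0; pose M := \sum_x `|G x|.
have GM x : `|G x| <= M.
  by rewrite /M (bigD1 x) //= lerDl sumr_ge0 // => y _.
have etaE : eta = (complex.Re eta)%:C by rewrite RRe_real // ger0_real ?ltW.
have h01 : 0 <= complex.Re eta < 1.
  by rewrite -lecR -ltcR -etaE eta1 ltW.
apply: (@vanishes_le _ 1 _ _ (vanishesZ (M *+ 2) (vanishes_geometric K1 h01))).
move=> N N0; rewrite mul1r.
have N0' : 0 < N%:R :> R[i] by rewrite ltr0n.
have M0 : 0 <= M by rewrite sumr_ge0.
rewrite normrM normfV normr_nat mulrC ler_pdivrMr //.
have := saving G M GM G0 N 0 N0; rewrite size_poly0 => /(_ isT).
under eq_bigr do rewrite hornerC -[e 0]/(e 0).
have -> : e (0 : R) = 1 by rewrite /e mulr0 cos0 sin0.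
under eq_bigr do rewrite mulr1.
move/le_trans; apply.
rewrite ger0_norm; last first.
  by rewrite mulr_ge0 ?mulrn_wge0 // lecR exprn_ge0 //; case/andP: h01.
by rewrite rmorphXn /= -etaE mulrAC.
Qed.

Variable f : gT -> R[i].

Definition corner_mean (x : gT) : R[i] :=
  #|H|%:R^-1 * \sum_(h in H) f (x * h)%g.

Lemma corner_mean_invariant x h : h \in H -> corner_mean (x * h)%g = corner_mean x.
Proof.
move=> hH; congr (_ * _); rewrite [RHS](reindex_inj (mulgI h)).
apply: eq_big => [h'|h' _]; first by rewrite mem_corner_groupM.
by rewrite mulgA.
Qed.

Lemma corner_mean_sum x : \sum_(h in H) f (x * h)%g = #|H|%:R * corner_mean x.
Proof.
rewrite mulVKf // pnatr_eq0 -lt0n; apply/card_gt0P; exists 1%g.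
exact: (corner_group1 gam_cut).
Qed.

Definition centred_product (x : gT) : R[i] := (f x - corner_mean x) * (corner_mean x)^*.

Lemma centred_product_free : corner_free gam d centred_product.
Proof.
move=> x _; rewrite (eq_bigr (fun h =>
    (f (x * h)%g - corner_mean x) * (corner_mean x)^*)); last first.
  by move=> h hH; rewrite /centred_product corner_mean_invariant.
rewrite -mulr_suml sumrB corner_mean_sum sumr_const mulr_natl subrr mul0r //.
Qed.

Lemma sum_residues (F : nat -> R[i]) q n0 m :
  \sum_(j < m) \sum_(i < q) F (q * j + (n0 + i))%N =
  \sum_(n < n0 + q * m) F n - \sum_(n < n0) F n.
Proof.
elim: m => [|m IHm]; first by rewrite big_ord0 muln0 addn0 subrr.
have -> : \sum_(n < n0 + q * m.+1) F n =
    \sum_(n < n0 + q * m) F n + \sum_(i < q) F (n0 + q * m + i)%N.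
  by rewrite mulnSr addnA big_split_ord.
rewrite big_ord_recr /= IHm addrAC; congr (_ + _ - _).
by apply: eq_bigr => i _; rewrite addnCA addnA.
Qed.

(** Let [f0] be the mean of [f] over the cosets of the corner group. Along the
    integers [f0] is eventually periodic, so [f] has zero correlation with it by
    total balance. But [f - f0] has zero correlation with [f0] too, its product
    with the conjugate of [f0] being corner-free. Hence [f0] has zero
    correlation with itself, that is, vanishes. *)
Lemma corner_free_balanced :
  (forall q r, (0 < q)%N -> vanishes (fun N => average N (fun n => f (gam (q * n + r))))) ->
  corner_free gam d f.
Proof.
move=> bal.
have [q [n0 [q0 per]]] := eventually_periodic_mod_corner_group k_gt1 gam_cut d.
pose f0 n := corner_mean (gam n).
have f0_per1 n : (n0 <= n)%N -> f0 (n + q)%N = f0 n.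
  move=> n0n; rewrite /f0 -(corner_mean_invariant (gam n) (per n n0n)).
  by rewrite mulKVg.
have f0_per n m : (n0 <= n)%N -> f0 (q * m + n)%N = f0 n.
  move=> n0n; elim: m => [|m IHm]; first by rewrite muln0.
  by rewrite mulnSr addnAC f0_per1 // (leq_trans n0n) // leq_addl.
pose D := \sum_(i < q) `|f0 (n0 + i)%N| ^+ 2.
pose S N := \sum_(n < N) centred_product (gam n).
have S_small := mean_free_vanishes centred_product_free.
pose lhs m := \sum_(i < q) (f0 (n0 + i)%N)^* *
  average m (fun j => f (gam (q * j + (n0 + i)))).
have lhs_small : vanishes lhs.
  by apply: vanishes_sum => i; apply: vanishesZ; apply: bal.
have S_small' : vanishes (fun m => m%:R^-1 * S (n0 + q * m)%N).
  have sub : vanishes (fun m => (n0 + q * m)%:R^-1 * S (n0 + q * m)%N).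
    move=> eps /S_small [N0 HN]; exists N0 => m Nm; apply: HN.
    by rewrite (leq_trans Nm) // (leq_trans (leq_pmull m q0)) // leq_addl.
  apply: (@vanishes_le _ (n0 + q)%:R _ _ sub) => m m0.
  have [m0' n0m'] : 0 < m%:R :> R[i] /\ 0 < (n0 + q * m)%:R :> R[i].
    by rewrite !ltr0n addn_gt0 muln_gt0 m0 q0 orbT.
  rewrite !normrM !normfV !normr_nat mulrA ler_wpM2r //.
  rewrite rmorph_nat ler_pdivlMr // mulrC ler_pdivrMr // -natrM ler_nat.
  by rewrite mulnDl leq_add2r leq_pmulr.
(* split [f = f0 + (f - f0)] in the correlation [lhs] over [m] periods *)
have key m : (0 < m)%N ->
    D = lhs m - (m%:R^-1 * S (n0 + q * m)%N - m%:R^-1 * S n0).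
  move=> m0; have mN0 : m%:R != 0 :> R[i] by rewrite pnatr_eq0 -lt0n.
  apply: (mulfI mN0); rewrite !mulrBr !mulVKf //.
  rewrite /S -(sum_residues (fun n => centred_product (gam n))).
  have -> : m%:R * lhs m = \sum_(i < q) (f0 (n0 + i)%N)^* *
      \sum_(j < m) f (gam (q * j + (n0 + i))).
    by rewrite /lhs mulr_sumr; apply: eq_bigr => i _;
       rewrite /average mulrCA mulVKf.
  rewrite exchange_big /= -sumrB /D mulr_sumr; apply: eq_bigr => i _.
  rewrite mulr_sumr -sumrB (eq_bigr (fun _ => `|f0 (n0 + i)%N| ^+ 2)).
    by rewrite sumr_const card_ord mulr_natl.
  move=> j _; rewrite /centred_product -/(f0 _) f0_per ?leq_addr //.
  by rewrite mulrBl mulrC opprB addrCA subrr addr0 normCK.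
have D0 : D = 0.
  apply: vanishes_cst.
  apply: (@vanishes_le _ 1 _ _ (vanishesD lhs_small
    (vanishesD (vanishesZ (-1) S_small') (vanishes_inv (S n0))))).
  move=> m m0; rewrite mul1r (key m m0) !mulN1r opprB.
  by rewrite [X in _ <= `|_ + X|]addrC.
have f0_0 i : (i < q)%N -> f0 (n0 + i)%N = 0.
  move=> iq; apply/eqP; rewrite -normr_eq0 -sqrf_eq0; apply/eqP.
  have Fi j : xpredT j -> 0 <= `|f0 (n0 + nat_of_ord (j : 'I_q))%N| ^+ 2.
    by rewrite exprn_ge0.
  exact: (psumr_eq0P Fi D0 (isT : xpredT (Ordinal iq))).
move=> _ [n <-]; rewrite corner_mean_sum.
have [n' n0n' <-] := gam_recurrent n n0.
have n'E : n' = (q * ((n' - n0) %/ q) + (n0 + (n' - n0) %% q))%N.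
  by rewrite addnCA mulnC -divn_eq subnKC.
by rewrite -/(f0 n') n'E f0_per ?leq_addr // f0_0 ?mulr0 // ltn_mod.
Qed.

End ZeroMean.

(** * Power saving for totally balanced invertible automatic sequences *)

Local Open Scope complex_scope.
Local Open Scope classical_set_scope.

Theorem proposition9p3 (R : realType) (k : nat) (k_gt1 : (1 < k)%N)
    (d : nat) (d_gt0 : (0 < d)%N)
    (Omega : set R[i]) (a : nat -> Omega)
    (a_automatic : invertible_automatic k_gt1 a)
    (a_balanced : totally_balanced (fun n => sval (a n))) :
  exists c C : R, 0 < c /\
    forall N : nat, (0 < N)%N ->
      (ereal_sup [set (Normc.normc
                         (average N (fun n => sval (a n) * e p.[n%:R])))%:E
                 | p in [set p : {poly R} | (size p <= d.+1)%N]]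
       <= (C * N%:R `^ (- c))%:E)%E.
Proof.
have [gT [g [proj [g_tm aE]]]] := a_automatic.
pose gam n := g (expansion k_gt1 n).
have gam_cut m j n : (n < k ^ j)%N -> gam (m * k ^ j + n)%N = (gam m * gam n)%g.
  exact: thue_morse_cut.
pose f x : R[i] := sval (proj x).
have aE' n : sval (a n) = f (gam n) by rewrite aE.
have f_free : corner_free gam d f.
  apply: (corner_free_balanced k_gt1 gam_cut) => q r q0.
  apply: vanishes_cvg; have [_ /(_ q r q0)] := a_balanced.
  have -> // : (fun n => f (gam (q * n + r)%N)) = (fun n => sval (a (q * n + r)%N)).
  by apply/funext => n; rewrite aE'.
have [K [eta [K1 eta0 eta1 saving]]] :=
  long_sum_saving (@e_sub R) (@norm_e R) k_gt1 gam_cut d.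
pose h := complex.Re eta.
have etaE : eta = h%:C by rewrite RRe_real // ger0_real ?ltW.
have h01 : 0 < h < 1 by rewrite -!ltcR -etaE eta0 eta1.
have lnK0 : 0 < ln K%:R :> R by rewrite ln_gt0 // ltr1n.
pose M : R := \sum_x Normc.normc (f x).
have fM x : `|f x| <= M%:C.
  rewrite -[`|_|]/((Normc.normc (f x))%:C) lecR /M (bigD1 x) //= lerDl.
  by apply: sumr_ge0 => y _; rewrite -lecR; exact: (normr_ge0 (f y)).
have M0 : 0 <= M by rewrite -lecR; exact: le_trans (normr_ge0 _) (fM 1%g).
exists (- (ln h / ln K%:R)), (M *+ 2 * h^-1); split.
  by rewrite oppr_gt0 pmulr_llt0 ?invr_gt0 // ln_lt0.
move=> N N0; apply: ge_ereal_sup => _ [p /= sp <-]; rewrite lee_fin.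
apply: (@le_trans _ _ (M *+ 2 * h ^+ trunc_log K N)); last first.
  by rewrite -mulrA ler_wpM2l ?mulrn_wge0 // geometric_power_saving.
rewrite -lecR -[(Normc.normc _)%:C]/(`|average N _|) /average.
have N0' : 0 < N%:R :> R[i] by rewrite ltr0n.
rewrite normrM normfV normr_nat mulrC ler_pdivrMr //.
under eq_bigr do rewrite aE'.
apply: le_trans (saving f _ fM f_free N p N0 sp) _.
by rewrite rmorphM rmorphXn rmorphMn /= -etaE mulrAC.
Qed.
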